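(* Let $\rho_0\in \mathrm{L}^\infty\cap \mathrm{BV}(\mathbb{R};\mathbb{R}_+)$ and $T>0$. If the CFL condition $$\frac{\Delta t}{\Delta x}\le \min\left\{\frac{8-27\alpha}{27\|\partial_\rho f\|},\ \frac{2}{27\|\partial_\rho f\|},\ \frac{\alpha}{\|\partial_\rho f\|}\right\}$$ holds, then there exist constants $\mathcal{A},\mathcal{B}>0$, independent of the mesh size $\Delta x$ (with $\lambda=\Delta t/\Delta x$ fixed), such that the approximate solutions $\rho_\Delta$ computed using the MUSCL-Hancock scheme described in the context satisfy $$\mathrm{TV}(\rho_\Delta(t,\cdot))\le \exp(\mathcal{A}T)\Big(\sum_{j\in\mathbb{Z}}|\rho^0_{j+1}-\rho^0_j|\Big)+\mathcal{B}\big(\exp(\mathcal{A}T)-1\big)\qquad\text{for all } t\in[0,T].$$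
   Context: Notation: $\mathbb{R}_+=[0,\infty)$; $\|\cdot\|$ denotes the $\mathrm{L}^\infty$ norm (for $\partial_\rho f$ over $\mathbb{R}\times\mathbb{R}$); $\mathrm{TV}$ is the total variation seminorm; $\mathrm{BV}(\mathbb{R})$ is the space of $\mathrm{L}^1(\mathbb{R})$ functions of bounded total variation. Problem: $\partial_t\rho+\partial_x f(\rho,A(t,x))=0$ on $(0,\infty)\times\mathbb{R}$, $\rho(0,x)=\rho_0(x)$, where $A(t,x)=\int_{\mathbb{R}}\mu(x-y)\rho(t,y)\,dy$. Standing hypotheses on $f=f(\rho,A):\mathbb{R}\times\mathbb{R}\to\mathbb{R}$ and $\mu:\mathbb{R}\to\mathbb{R}$: $f\in \mathrm{C}^2(\mathbb{R}\times\mathbb{R};\mathbb{R})$, $\partial_\rho f\in \mathrm{L}^\infty(\mathbb{R}\times\mathbb{R})$, $f(0,A)=0$ for all $A\in\mathbb{R}$; there is $M>0$ with $|\partial_A f(\rho,A)|,\ |\partial^2_{AA}f(\rho,A)|\le M|\rho|$ for all $\rho,A$; $\partial_\rho f\in \mathrm{W}^{1,\infty}(\mathbb{R}\times\mathbb{R})$; $\mu\in \mathrm{C}_c^2\cap \mathrm{W}^{2,\infty}(\mathbb{R};\mathbb{R})$. Scheme. Fix $\theta\in[0,\tfrac12]$, $\alpha\in(0,\tfrac{8}{27})$, $\Delta x,\Delta t>0$, $\lambda=\Delta t/\Delta x$, $x_j=j\Delta x$, $x_{j+1/2}=x_j+\Delta x/2$, $t^n=n\Delta t$, $\mu_j=\mu(j\Delta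 x)$ ($j\in\mathbb{Z}$, $n\in\mathbb{N}\cup\{0\}$). Set $\rho^0_j=\frac1{\Delta x}\int_{x_{j-1/2}}^{x_{j+1/2}}\rho_0(x)\,dx$. Given $(\rho^n_j)_{j\in\mathbb{Z}}$: (1) Slopes: $\sigma^n_j=2\theta\,\mathrm{minmod}\big(\rho^n_j-\rho^n_{j-1},\ \tfrac12(\rho^n_{j+1}-\rho^n_{j-1}),\ \rho^n_{j+1}-\rho^n_j\big)$, where minmod of several numbers is $0$ unless all are nonzero with the same sign, in which case it is the one of smallest absolute value. Face values: $\rho^{n,-}_{j+1/2}=\rho^n_j+\tfrac12\sigma^n_j$, $\rho^{n,+}_{j-1/2}=\rho^n_j-\tfrac12\sigma^n_j$. (2) Convolutions: $A^n_j=\Delta x\sum_{l\in\mathbb{Z}}\mu_{j-l}\rho^n_l$, $s^n_j=\theta(A^n_{j+1}-A^n_{j-1})$, $A^{n,-}_{j+1/2}=A^n_j+\tfrac12 s^n_j$, $A^{n,+}_{j-1/2}=A^n_j-\tfrac12 s^n_j$. (3) Mid-time values: $\rho^{n+1/2,-}_{j+1/2}=\rho^{n,-}_{j+1/2}-\tfrac{\lambda}{2}\delta^n_j$ and $\rho^{n+1/2,+}_{j-1/2}=\rho^{n,+}_{j-1/2}-\tfrac{\lambda}{2}\delta^n_j$, with $\delta^n_j=f(\rho^{n,-}_{j+1/2},A^{n,-}_{j+1/2})-f(\rho^{n,+}_{j-1/2},A^{n,+}_{j-1/2})$. (4) Mid-time convolution: $A^{n+1/2}_{j+1/2}=\tfrac{\Delta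 x}{2}\sum_{l\in\mathbb{Z}}\big[\mu_{j+1-l}\,\rho^{n+1/2,+}_{l-1/2}+\mu_{j-l}\,\rho^{n+1/2,-}_{l+1/2}\big]$. (5) Update: $\rho^{n+1}_j=\rho^n_j-\lambda\big[F^{n+1/2}_{j+1/2}-F^{n+1/2}_{j-1/2}\big]$, where $F^{n+1/2}_{j+1/2}=F(\rho^{n+1/2,-}_{j+1/2},\rho^{n+1/2,+}_{j+1/2},A^{n+1/2}_{j+1/2})$ and $F(u,v,A)=\tfrac12\big(f(u,A)+f(v,A)\big)-\tfrac{\alpha}{2\lambda}(v-u)$. Approximate solution: $\rho_\Delta(t,x)=\rho^n_j$ for $(t,x)\in[t^n,t^{n+1})\times[x_{j-1/2},x_{j+1/2})$, $n\in\mathbb{N}\cup\{0\}$, $j\in\mathbb{Z}$. In the CFL condition, quotients by $\|\partial_\rho f\|$ are read as $+\infty$ if $\|\partial_\rho f\|=0$. *)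

(* Defs.v *)
From HB Require Import structures.
From mathcomp Require Import all_boot all_order all_algebra.
From mathcomp Require Import all_classical all_reals all_analysis.

Set Implicit Arguments.
Unset Strict Implicit.
Unset Printing Implicit Defensive.

Import Order.TTheory GRing.Theory Num.Theory.
Import numFieldNormedType.Exports.

Local Open Scope classical_set_scope.
Local Open Scope ring_scope.

Section function_spaces.
Context {R : realType}.

Definition d_rho (g : R * R -> R) (p : R * R) : R :=
  derive1 (fun r => g (r, p.2)) p.1.

Definition d_A (g : R * R -> R) (p : R * R) : R :=
  derive1 (fun a => g (p.1, a)) p.2.

Definition derivable2 (g : R * R -> R) : Prop :=
  forall p, derivable (fun r => g (r, p.2)) p.1 1 /\
            derivable (fun a => g (p.1, a)) p.2 1.

Fixpoint Ck2 (k : nat) (g : R * R -> R) : Prop :=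
  continuous g /\
  if k is k'.+1 then [/\ derivable2 g, Ck2 k' (d_rho g) & Ck2 k' (d_A g)]
  else True.

Definition Ck1 (k : nat) (g : R -> R) : Prop :=
  (forall i, (i < k)%N -> forall x, derivable (derive1n i g) x 1) /\
  (forall i, (i <= k)%N -> continuous (derive1n i g : R -> R)).

Definition compact_support {T : topologicalType} (g : T -> R) : Prop :=
  compact (closure [set x | g x != 0]).

Definition Leb2 : {measure set (measurableTypeR R * measurableTypeR R) -> \bar R}
  := (lebesgue_measure \x lebesgue_measure)%E.

Definition test1 (phi : R -> R) : Prop :=
  (forall k, Ck1 k phi) /\ compact_support phi.

Definition test2 (phi : R * R -> R) : Prop :=
  (forall k, Ck2 k phi) /\ compact_support phi.

Definition weak_deriv (g h : R -> R) : Prop :=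
  forall phi, test1 phi ->
    \int[lebesgue_measure]_x (g x * derive1 phi x) =
    - \int[lebesgue_measure]_x (h x * phi x).

Definition weak_d_rho (g h : R * R -> R) : Prop :=
  forall phi, test2 phi ->
    \int[Leb2]_p (g p * d_rho phi p) = - \int[Leb2]_p (h p * phi p).

Definition weak_d_A (g h : R * R -> R) : Prop :=
  forall phi, test2 phi ->
    \int[Leb2]_p (g p * d_A phi p) = - \int[Leb2]_p (h p * phi p).

Definition W2oo_R (g : R -> R) : Prop :=
  exists g1 g2 : R -> R,
    [/\ g \in Lfun lebesgue_measure +oo%E, g1 \in Lfun lebesgue_measure +oo%E,
        g2 \in Lfun lebesgue_measure +oo%E, weak_deriv g g1 & weak_deriv g1 g2].

Definition W1oo_R2 (g : R * R -> R) : Prop :=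
  exists g1 g2 : R * R -> R,
    [/\ g \in Lfun Leb2 +oo%E, g1 \in Lfun Leb2 +oo%E,
        g2 \in Lfun Leb2 +oo%E, weak_d_rho g g1 & weak_d_A g g2].

Definition variationR (g : R -> R) : \bar R :=
  ereal_sup [set total_variation ab.1 ab.2 g | ab in [set ab | ab.1 <= ab.2]].

(* Total variation of an L^1_loc class: the pointwise variation is minimized
   over all representatives (essential variation), so that the value does not
   depend on the representative [g]. *)
Definition TVR (g : R -> R) : \bar R :=
  ereal_inf [set variationR h | h in ae_eq lebesgue_measure setT g].

Definition BVR (g : R -> R) : Prop :=
  g \in Lfun lebesgue_measure 1%E /\ (TVR g < +oo)%E.

End function_spaces.

Section hypotheses.
Context {R : realType}.

Definition flux_hyp (f : R * R -> R) : Prop :=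
  [/\ Ck2 2 f,
      d_rho f \in Lfun Leb2 +oo%E,
      (forall a, f (0, a) = 0),
      (exists M : R, 0 < M /\ forall r a,
         `|d_A f (r, a)| <= M * `|r| /\ `|d_A (d_A f) (r, a)| <= M * `|r|) &
      W1oo_R2 (d_rho f)].

Definition kernel_hyp (mu : R -> R) : Prop :=
  [/\ Ck1 2 mu, compact_support mu & W2oo_R mu].

(* In [\bar R] one has [0^-1 = +oo], and the three numerators below are
   positive when [0 < alpha < 8 / 27]. *)
Definition CFL (f : R * R -> R) (alpha lam : R) : Prop :=
  let N : \bar R := ('N[Leb2]_+oo[EFin \o d_rho f])%E in
  (lam%:E <= Order.min (Order.min ((8 - 27 * alpha)%:E / (27%:E * N))
                                  (2%:E / (27%:E * N)))
                       (alpha%:E / N))%E.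

End hypotheses.

Section scheme.
Context {R : realType}.
Variables (f : R * R -> R) (mu : R -> R) (theta alpha dx dt : R).
Implicit Types (rho : int -> R) (j l : int).

Let lam := dt / dx.

Definition cell_center j : R := j%:~R * dx.
Definition cell_left j : R := cell_center j - dx / 2.
Definition cell_right j : R := cell_center j + dx / 2.

Definition minmod3 (a b c : R) : R :=
  if [&& 0 < a, 0 < b & 0 < c] then Order.min a (Order.min b c)
  else if [&& a < 0, b < 0 & c < 0] then Order.max a (Order.max b c)
  else 0.

Definition slope rho j : R :=
  2 * theta * minmod3 (rho j - rho (j - 1))
                      ((rho (j + 1) - rho (j - 1)) / 2)
                      (rho (j + 1) - rho j).

(* All quantities below are indexed by the cell: in cell [j], the suffix [r]
   is the trace at the right face [x_(j+1/2)] (superscript "-") and [l] the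
   trace at the left face [x_(j-1/2)] (superscript "+"). *)
Definition rho_r rho j : R := rho j + slope rho j / 2.
Definition rho_l rho j : R := rho j - slope rho j / 2.

(* The sums over [int] have finitely many nonzero terms when [mu] has compact
   support; [\sum_(l \in A)] is 0 by convention otherwise. *)
Definition conv_c rho j : R :=
  dx * \sum_(l \in [set: int]) (mu (cell_center (j - l)) * rho l).

Definition conv_slope rho j : R :=
  theta * (conv_c rho (j + 1) - conv_c rho (j - 1)).
Definition conv_r rho j : R := conv_c rho j + conv_slope rho j / 2.
Definition conv_l rho j : R := conv_c rho j - conv_slope rho j / 2.

Definition delta rho j : R :=
  f (rho_r rho j, conv_r rho j) - f (rho_l rho j, conv_l rho j).
Definition mid_r rho j : R := rho_r rho j - lam / 2 * delta rho j.
Definition mid_l rho j : R := rho_l rho j - lam / 2 * delta rho j.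

(* [mid_conv rho j] and [face_flux rho j] live at the face [x_(j+1/2)]. *)
Definition mid_conv rho j : R :=
  dx / 2 * \sum_(l \in [set: int])
    (mu (cell_center (j + 1 - l)) * mid_l rho l +
     mu (cell_center (j - l)) * mid_r rho l).

Definition num_flux (u v a : R) : R :=
  (f (u, a) + f (v, a)) / 2 - alpha / (2 * lam) * (v - u).

Definition face_flux rho j : R :=
  num_flux (mid_r rho j) (mid_l rho (j + 1)) (mid_conv rho j).

Definition update rho j : R :=
  rho j - lam * (face_flux rho j - face_flux rho (j - 1)).

Definition cell_average (rho0 : R -> R) j : R :=
  dx^-1 * \int[lebesgue_measure]_(x in `[cell_left j, cell_right j]) rho0 x.

Definition muscl (rho0 : R -> R) (n : nat) : int -> R :=
  iter n update (cell_average rho0).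

Definition rho_Delta (rho0 : R -> R) (t x : R) : R :=
  muscl rho0 (Num.truncn (t / dt)) (Num.floor (x / dx + 2^-1)).

Lemma rho_DeltaE (rho0 : R -> R) n j t x : 0 < dx -> 0 < dt ->
  n%:R * dt <= t < n.+1%:R * dt -> cell_left j <= x < cell_right j ->
  rho_Delta rho0 t x = muscl rho0 n j.
Proof.
move=> dx0 dt0 /andP[t1 t2] /andP[x1 x2]; rewrite /rho_Delta.
have -> : Num.truncn (t / dt) = n.
  by apply: truncn_def; rewrite ler_pdivlMr// ltr_pdivrMr// t1 t2.
have -> // : Num.floor (x / dx + 2^-1) = j.
apply: floor_def.
have -> : x / dx + 2^-1 = (x + dx / 2) / dx.
  by rewrite mulrDl mulrAC divff ?mul1r ?gt_eqF.
rewrite ler_pdivlMr// ltr_pdivrMr// -lerBlDr x1/=.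
rewrite intrD mulrDl mul1r -ltrBrDr (lt_le_trans x2)//.
by rewrite /cell_right /cell_center -addrA lerD2l {2}(splitr dx) addrK.
Qed.

End scheme.

(* Main.v *)
Require Import Defs.
From HB Require Import structures.
From mathcomp Require Import all_boot all_order all_algebra.
From mathcomp Require Import all_classical all_reals all_analysis.
From mathcomp Require Import finmap measurable_realfun ess_sup_inf ring lra.

Set Implicit Arguments.
Unset Strict Implicit.
Unset Printing Implicit Defensive.

Import Order.TTheory GRing.Theory Num.Theory.
Import numFieldNormedType.Exports.

Local Open Scope classical_set_scope.
Local Open Scope ring_scope.

(** The numerical flux is the average of the fluxes at the two traces of a face,
    with viscosity [alpha], and the traces come from limited slopes and a half
    step in time. If the nonlocal states were constant in space, the scheme would
    have Harten's incremental form: every new average is a convex combination of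
    three neighbouring old ones, and the new jumps are a redistribution of the
    old ones ([harten_form], [bisum_exchange]), so that neither the maximum nor
    the total variation would grow. Everything else is an estimate of the error
    made by freezing the nonlocal states.

    This error is a sum of gaps [f (x, a) - f (x, b)] where [x] is a trace and
    [a], [b] are nearby nonlocal states. Convolution with a kernel of class C^2
    gives states whose first differences are of order [dx] and whose second
    differences are of order [dx ^ 2], the constants depending on the kernel and
    on the mass only ([close_face_conv], [close_mid_conv]). The averages remain
    nonnegative and their mass is conserved ([update_ge0], [bisum_update]), so
    these constants are the same at all times. A gap is of order [dx * x] because
    [d_A f] is bounded by a multiple of the density; hence the maximum grows by a
    factor [1 + O(dt)] in one step ([update_le]), and up to time [T] all densities
    and states lie in a fixed compact box. There the mixed second derivative of
    [f] is bounded by continuity, and the gaps of neighbouring cells differ by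
    [O(dx)] times the jump of the averages plus [O(dx ^ 2)] times the density
    ([gap_step]). Summed over the cells, this gives
    [TV' <= (1 + 3 * rate * dt) * TV + 3 * source * L * dt]
    ([bisum_jump_update]), and the bound follows by iterating it [n] times with
    [n * dt <= T] ([muscl_jumps]). All constants depend on [dx] and [dt] through
    their quotient only.

    Finally the essential variation of the approximate solution is at most the
    sum of the jumps of its averages ([TVR_piecewise_constant_le]), and the
    initial averages have mass at most [\int rho0] and are bounded by the essential
    supremum of [rho0]. Sums over the integers are taken in the extended reals,
    where they can be split and shifted freely as long as the terms are
    nonnegative. *)

(** * Nonnegative families indexed by the integers *)

Section bisum.
Context {R : realType}.
Implicit Types u v : int -> R.

Definition bisum u : \bar R := (\esum_(j in [set: int]) (u j)%:E)%E.

Lemma bisum_ge0 u : (forall j, 0 <= u j) -> (0 <= bisum u)%E.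
Proof. by move=> u0; apply: esum_ge0 => j _; rewrite lee_fin. Qed.

Lemma le_bisum u v : (forall j, u j <= v j) -> (bisum u <= bisum v)%E.
Proof. by move=> uv; apply: le_esum => j _; rewrite lee_fin. Qed.

Lemma eq_bisum u v : u =1 v -> bisum u = bisum v.
Proof. by move=> /funext ->. Qed.

Lemma bisumD u v : (forall j, 0 <= u j) -> (forall j, 0 <= v j) ->
  (bisum (fun j => u j + v j)%R = bisum u + bisum v)%E.
Proof. by move=> u0 v0; rewrite /bisum -esumD// => j _; rewrite lee_fin. Qed.

Lemma bisum_shift k u : bisum (fun j => u (j + k)) = bisum u.
Proof.
rewrite /bisum [RHS](reindex_esum setT setT (fun j : int => j + k))//.
by rewrite setTT_bijective; exists (fun j => j - k) => j; rewrite ?addrK ?subrK.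
Qed.

Lemma sum_le_bisum (s : seq int) u : uniq s -> (forall j, 0 <= u j) ->
  ((\sum_(l <- s) u l)%:E <= bisum u)%E.
Proof.
move=> us u0; apply: esum_ge; exists [set` s].
  by split=> //; exact: finite_seq.
by rewrite -fsbig_seq// sumEFin.
Qed.

Lemma bisum_le u (B : R) :
  (forall s : seq int, uniq s -> \sum_(l <- s) u l <= B) ->
  (bisum u <= B%:E)%E.
Proof.
move=> uB; apply: ge_ereal_sup => _ [X [finX _] <-].
rewrite fsbig_finite// sumEFin lee_fin uB//; exact: fset_uniq.
Qed.

Lemma bisumZ_le c u (B : R) : 0 <= c -> (forall j, 0 <= u j) ->
  (bisum u <= B%:E)%E -> (bisum (fun j => c * u j)%R <= (c * B)%:E)%E.
Proof.
move=> c0 u0 uB; apply: bisum_le => s us; rewrite -mulr_sumr ler_wpM2l//.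
by rewrite -lee_fin; apply: le_trans uB; exact: sum_le_bisum.
Qed.

Lemma bisumD_le u v (B C : R) : (forall j, 0 <= u j) -> (forall j, 0 <= v j) ->
  (bisum u <= B%:E)%E -> (bisum v <= C%:E)%E ->
  (bisum (fun j => u j + v j)%R <= (B + C)%:E)%E.
Proof. by move=> u0 v0 uB vC; rewrite bisumD// EFinD leeD. Qed.

(** Whatever an index sends to its two neighbours is collected by them, so the
    total is the same, possibly infinite. Both the conservation of mass and the
    decay of the total variation for frozen nonlocal states come from this. *)
Lemma bisum_exchange X U V : (forall j, 0 <= X j) -> (forall j, 0 <= U j) ->
  (forall j, 0 <= V j) ->
  bisum (fun j => X j + U (j - 1) + V (j + 1)) =
  bisum (fun j => X j + U j + V j).
Proof.
move=> X0 U0 V0.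
have split3 (Y Z : int -> R) :
    (forall j, 0 <= Y j) -> (forall j, 0 <= Z j) ->
    (bisum (fun j => X j + Y j + Z j)%R = bisum X + bisum Y + bisum Z)%E.
  by move=> Y0 Z0; rewrite !bisumD// => j; rewrite addr_ge0.
by rewrite !split3// (bisum_shift (-1) U) (bisum_shift 1 V).
Qed.

End bisum.

Section weighted_sum.
Context {R : realType}.
Implicit Types (w v u : int -> R).

(** A discrete convolution at one point, [w] being the shifted kernel. *)
Definition wsum w u : R := \sum_(l \in [set: int]) (w l * u l).

Definition fin_weight w := finite_set [set l | w l != 0].

Lemma wsumE (D : {fset int}) w u : (forall l, l \notin D -> w l = 0) ->
  wsum w u = \sum_(l <- D) w l * u l.
Proof. by move=> Dw; apply: fsbigTE => l /Dw ->; rewrite mul0r. Qed.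

Lemma fin_weightP w : fin_weight w ->
  exists D : {fset int}, forall l, l \notin D -> w l = 0.
Proof.
move=> /finite_fsetP [D wD]; exists D => l lD; apply/eqP; apply: contraNT lD.
move=> wl; have : [set` D] l by rewrite -wD.
by [].
Qed.

Lemma wsumBl w v u : fin_weight w -> fin_weight v ->
  wsum (fun l => w l - v l) u = wsum w u - wsum v u.
Proof.
move=> /fin_weightP[D wD] /fin_weightP[E vE].
rewrite !(@wsumE (D `|` E)%fset).
- by rewrite -sumrB; apply: eq_bigr => l _; rewrite mulrBl.
- by move=> l; rewrite inE negb_or => /andP[_ /vE].
- by move=> l; rewrite inE negb_or => /andP[/wD].
- by move=> l; rewrite inE negb_or => /andP[/wD -> /vE ->]; rewrite subrr.
Qed.

Lemma wsum_pair w v u u' : fin_weight w -> fin_weight v ->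
  \sum_(l \in [set: int]) (w l * u l + v l * u' l) = wsum w u + wsum v u'.
Proof.
move=> /fin_weightP[D wD] /fin_weightP[E vE].
rewrite (@fsbigTE _ _ _ _ (D `|` E)%fset); last first.
  by move=> l; rewrite inE negb_or => /andP[/wD -> /vE ->]; rewrite !mul0r addr0.
rewrite !(@wsumE (D `|` E)%fset) ?big_split//.
- by move=> l; rewrite inE negb_or => /andP[_ /vE].
- by move=> l; rewrite inE negb_or => /andP[/wD].
Qed.

Lemma fin_weightB w v : fin_weight w -> fin_weight v ->
  fin_weight (fun l => w l - v l).
Proof.
move=> fw fv; apply: (@sub_finite_set _ _
  ([set l | w l != 0] `|` [set l | v l != 0])).
  move=> l /=; have [->|] := eqVneq (w l) 0; last by left.
  by rewrite sub0r oppr_eq0; right.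
by rewrite finite_setU.
Qed.

Lemma wsum_le w u (W B : R) : fin_weight w -> (forall l, 0 <= u l) ->
  (forall l, `|w l| <= W) -> (bisum u <= B%:E)%E -> `|wsum w u| <= W * B.
Proof.
move=> /fin_weightP[D wD] u0 wW uB; rewrite (wsumE _ wD).
apply: le_trans (ler_norm_sum _ _ _) _.
have W0 : 0 <= W by apply: le_trans (wW 0).
apply: (@le_trans _ _ (W * \sum_(l <- D) u l)).
  rewrite mulr_sumr; apply: ler_sum => l _.
  by rewrite normrM (ger0_norm (u0 l)) ler_wpM2r.
rewrite ler_wpM2l// -lee_fin; apply: le_trans uB.
by apply: sum_le_bisum => //; exact: fset_uniq.
Qed.

End weighted_sum.

(** * Elementary calculus for the kernel and the flux *)

Section calculus.
Context {R : realType}.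
Implicit Types g : R -> R.

Lemma mvt_all g x y : (forall z, derivable g z 1) ->
  exists c, [/\ Order.min x y <= c, c <= Order.max x y &
                g x - g y = derive1 g c * (x - y)].
Proof.
move=> dg; wlog xy : x y / y <= x => [H|].
  have [yx|xy] := orP (le_total y x); first exact: H.
  have [c [c1 c2 e]] := H _ _ xy; exists c; rewrite minC maxC; split => //.
  by rewrite -opprB e -mulrN opprB.
have [| |c] := @MVT_segment R g (derive1 g) y x xy.
- move=> z _; rewrite derive1E; exact: derivableP.
- by apply: derivable_within_continuous => z _; exact: dg.
rewrite in_itv/= => /andP[c1 c2] e; exists c; split => //.
- by rewrite ge_min c1 orbT.
- by rewrite le_max c2.
Qed.

Lemma lip_of_deriv g (m x y : R) : (forall z, derivable g z 1) ->
  (forall z, `|derive1 g z| <= m) -> `|g x - g y| <= m * `|x - y|.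
Proof.
move=> dg gm; have [c [_ _ ->]] := mvt_all x y dg.
by rewrite normrM ler_wpM2r.
Qed.

(** Two increments of [g] are compared by moving one onto the other: the
    difference of the steps costs a first derivative, and the displacement of
    the intermediate points a second one. *)
Lemma increment_diff g (m1 m2 a b c d : R) :
  (forall z, derivable g z 1) -> (forall z, derivable (derive1 g) z 1) ->
  (forall z, `|derive1 g z| <= m1) ->
  (forall z, `|derive1 (derive1 g) z| <= m2) ->
  `|(g a - g b) - (g c - g d)| <=
    m1 * `|(a - b) - (c - d)|
    + m2 * (`|a - c| + `|a - b| + `|c - d|) * `|c - d|.
Proof.
move=> dg ddg g1 g2; have [s [s1 s2 ->]] := mvt_all a b dg.
have [t [t1 t2 ->]] := mvt_all c d dg.
have -> : derive1 g s * (a - b) - derive1 g t * (c - d) =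
  derive1 g s * ((a - b) - (c - d)) + (derive1 g s - derive1 g t) * (c - d).
  by ring.
apply: le_trans (ler_normD _ _) _; rewrite !normrM lerD ?ler_wpM2r//.
apply: le_trans (lip_of_deriv s t ddg g2) _; rewrite ler_wpM2l//.
  exact: le_trans (g2 s).
have h : forall u v w : R, Order.min u v <= w -> w <= Order.max u v ->
    `|w - u| <= `|u - v|.
  move=> u v w; case: (leP u v) => uv wu wv.
    by rewrite ger0_norm ?ler0_norm ?subr_ge0 ?subr_le0// opprB lerD2r.
  by rewrite ler0_norm ?gtr0_norm ?subr_gt0 ?subr_le0// opprB lerD2l lerN2.
have -> : s - t = (s - a) + (a - c) + (c - t) by ring.
apply: le_trans (ler_normD _ _) _; rewrite (distrC c t) lerD ?h//.
by apply: le_trans (ler_normD _ _) _; rewrite addrC lerD2l h.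
Qed.

Lemma second_difference g (m x h : R) :
  (forall z, derivable g z 1) -> (forall z, derivable (derive1 g) z 1) ->
  (forall z, `|derive1 (derive1 g) z| <= m) -> 
  `|g (x + h) - 2 * g x + g (x - h)| <= m * h ^+ 2.
Proof.
move=> dg ddg gm.
(* the second difference is an increment of the forward difference p *)
pose p y := g (y + h) - g y.

have dp (z : R) : is_derive z 1 p (derive1 g (z + h) - derive1 g z).
  have D1 (y : R) : is_derive y 1 g (derive1 g y).
    by rewrite derive1E; exact: derivableP.
  apply: is_deriveB; rewrite -[derive1 g (z + h)]mulr1.
  apply: is_derive1_comp; exact: is_derive_shift.
have dpE (z : R) : derive1 p z = derive1 g (z + h) - derive1 g z.
  by rewrite derive1E; apply: derive_val.
have -> : g (x + h) - 2 * g x + g (x - h) = p x - p (x - h).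
  by rewrite /p subrK; ring.
have -> : m * h ^+ 2 = (m * `|h|) * `|x - (x - h)|.
  by rewrite opprB addrCA subrr addr0 -mulrA -expr2 real_normK ?num_real.
apply: lip_of_deriv => z; first by have [] := dp z.
rewrite dpE; apply: le_trans (lip_of_deriv _ _ ddg gm) _.
by rewrite addrAC subrr add0r.
Qed.

Lemma derive1_zero_outside g (K : set R) : closed K ->
  (forall x, ~ K x -> g x = 0) -> forall x, ~ K x -> derive1 g x = 0.
Proof.
move=> cK gK x Kx; rewrite derive1E.
rewrite (@near_eq_derive _ _ _ g (cst 0)) ?derive_cst//.
have : nbhs x (~` K) by apply: open_nbhs_nbhs; split => //; exact: closed_openC.
by apply: filterS => y; exact: gK.
Qed.

Lemma bounded_of_compact_support g (K : set R) : compact K ->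
  continuous g -> (forall x, ~ K x -> g x = 0) ->
  exists m, 0 <= m /\ forall x, `|g x| <= m.
Proof.
move=> cK cg gK; have /compact_bounded[m [_ mK]] : compact (g @` K).
  by apply: continuous_compact => //; exact: continuous_subspaceT.
exists (`|m| + 1); split => [|x]; first by rewrite addr_ge0.
have [Kx|/gK ->] := pselect (K x); last by rewrite normr0 addr_ge0.
by apply: mK; [rewrite ltr_pwDr// ler_norm|exists x].
Qed.

End calculus.

Section kernel.
Context {R : realType}.

(** A kernel of class C^2 with compact support is bounded with its first two
    derivatives; the scheme sees them through finite differences only. *)
Lemma kernel_bounds (mu : R -> R) : kernel_hyp mu ->
  exists2 B : R, (forall x, B < `|x| -> mu x = 0) & exists m0 m1 m2 : R,
  [/\ 0 <= m0, 0 <= m1, 0 <= m2 &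
  [/\ forall x, `|mu x| <= m0,
      forall x h, `|mu (x + h) - mu x| <= m1 * `|h| &
      forall x h, `|mu (x + h) - 2 * mu x + mu (x - h)| <= m2 * h ^+ 2]].
Proof.
move=> [[dmu cmu] smu _].
pose K := closure [set x | mu x != 0].
have cK : closed K by exact: closed_closure.
have K0 x : ~ K x -> mu x = 0.
  move=> Kx; apply/eqP; apply/negPn/negP => /= mx; apply: Kx.
  exact: subset_closure.
have K1 := derive1_zero_outside cK K0.
have K2 := derive1_zero_outside cK K1.
have [m0 [m00 b0]] := bounded_of_compact_support smu (cmu 0%N isT) K0.
have [m1 [m10 b1]] := bounded_of_compact_support smu (cmu 1%N isT) K1.
have [m2 [m20 b2]] := bounded_of_compact_support smu (cmu 2%N isT) K2.
have d0 := dmu 0%N isT; have d1 := dmu 1%N isT.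
have /compact_bounded[B [_ BK]] := smu.
exists (`|B| + 1).
  move=> x xB; apply: K0 => Kx.
  have : `|x| <= `|B| + 1 by apply: BK => //; rewrite ltr_pwDr// ler_norm.
  by rewrite leNgt xB.
exists m0, m1, m2; split => //; split => // x h.
- by apply: le_trans (lip_of_deriv _ _ d0 b1) _; rewrite addrAC subrr add0r.
- exact: second_difference.
Qed.

End kernel.

Section flux.
Context {R : realType}.

Lemma Leb2_prod (A B : set (measurableTypeR R)) : measurable A -> measurable B ->
  Leb2 (A `*` B) = (lebesgue_measure A * lebesgue_measure B)%E.
Proof. by move=> mA mB; exact: product_measure1E. Qed.

(** Nonempty open sets of the plane have positive measure, so the essential
    supremum of a continuous function bounds all of its values. *)
Lemma le_Linfty_continuous (g : R * R -> R) (p : R * R) : continuous g ->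
  (`|g p|%:E <= 'N[Leb2]_+oo[EFin \o g])%E.
Proof.
move=> cg.
have measurable_ball (x e : R) : measurable (ball x e : set (measurableTypeR R)).
  by rewrite ball_itv; exact: measurable_itv.
have mX (x y e : R) : measurable
    (ball x e `*` ball y e : set (measurableTypeR R * measurableTypeR R)).
  exact: measurableX.
have ball_gt0 (q : R * R) (e : R) : 0 < e ->
    (0 < Leb2 (ball q.1 e `*` ball q.2 e))%E.
  move=> e0; rewrite Leb2_prod//.
  by rewrite !lebesgue_measure_ball ?ltW// mule_gt0// lte_fin mulrn_wgt0.
have T0 : (0 < Leb2 [set: measurableTypeR R * measurableTypeR R])%E.
  apply: lt_le_trans (ball_gt0 p 1 ltr01) _.
  apply: le_measure; [| |exact: subsetT]; apply: mem_set.
    exact: mX.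
  exact: measurableT.
rewrite unlock T0 leNgt; apply/negP => lt_p.
have [N [mN N0 sN]] := ess_sup_ge Leb2 (abse \o (EFin \o g)).
(* a real level between the essential supremum and the value at p *)
have [s [slt sE]] : exists s : R, s < `|g p| /\
    (ess_sup Leb2 (abse \o (EFin \o g)) <= s%:E)%E.
  case: (ess_sup _ _) lt_p => [s| |] //=; first by exists s.
  by exists (`|g p| - 1); rewrite ltrBlDr ltrDl ltr01 leNye.
have : \forall q \near p, s < `|g q|.
  have : (fun q => `|g q|) @ p --> `|g p| by apply: cvg_norm; exact: cg.
  move/cvgrPdist_lt => /(_ (`|g p| - s)); rewrite subr_gt0 => /(_ slt).
  apply: filterS => q /(le_lt_trans (ler_norm _)); lra.
move=> /nbhs_ballP[e /= e0 eb].
have := ball_gt0 p e e0; rewrite lt_neqAle eq_sym => /andP[/eqP + _]; apply.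
apply/eqP; rewrite eq_le measure_ge0 andbT -N0; apply: le_measure.
- by apply: mem_set; exact: mX.
- exact: mem_set.
move=> q [q1 q2]; apply: sN => /= h.
have := eb q (conj q1 q2); rewrite /= ltNge -lee_fin.
by rewrite (le_trans h sE).
Qed.

End flux.

Section flux_bounds.
Context {R : realType} (f : R * R -> R).
Implicit Types x y a b c d : R.

Lemma flux_lip_rho N : derivable2 f -> (forall p, `|d_rho f p| <= N) ->
  forall x y a, `|f (x, a) - f (y, a)| <= N * `|x - y|.
Proof.
move=> df fN x y a; apply: (@lip_of_deriv _ (fun r => f (r, a))) => z.
  by have [] := df (z, a).
exact: fN (z, a).
Qed.

Context (f2 : Ck2 2 f).
Let df : derivable2 f. Proof. by case: f2 => _ []. Qed.
Let dfA : derivable2 (d_A f). Proof. by case: f2 => _ [_ _ [_ []]]. Qed.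
Let dfr : derivable2 (d_rho f). Proof. by case: f2 => _ [_ [_ []]]. Qed.

Lemma flux_lip_A M : (forall r a, `|d_A f (r, a)| <= M * `|r|) ->
  forall x a b, `|f (x, a) - f (x, b)| <= M * `|x| * `|a - b|.
Proof.
move=> fM x a b; apply: (@lip_of_deriv _ (fun a => f (x, a))) => z.
  by have [] := df (x, z).
exact: fM.
Qed.

Lemma flux_increment_A M :
  (forall r a, `|d_A f (r, a)| <= M * `|r| /\ `|d_A (d_A f) (r, a)| <= M * `|r|) ->
  forall x a b c d, `|(f (x, a) - f (x, b)) - (f (x, c) - f (x, d))| <=
    M * `|x| * `|(a - b) - (c - d)|
    + M * `|x| * (`|a - c| + `|a - b| + `|c - d|) * `|c - d|.
Proof.
move=> fM x a b c d; apply: (@increment_diff _ (fun a => f (x, a))) => z.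
- by have [] := df (x, z).
- by have [] := dfA (x, z).
- by have [] := fM x z.
- by have [] := fM x z.
Qed.

(** The mixed second derivative is continuous, hence bounded on boxes. A box is
    enough for a solution that is bounded together with its convolutions, which
    is why the maximum of the averages is controlled first. *)
Lemma flux_mixed (m : R) : exists2 K, 0 <= K &
  forall x y a b, `|x| <= m -> `|y| <= m -> `|a| <= m -> `|b| <= m ->
  `|(f (x, a) - f (x, b)) - (f (y, a) - f (y, b))| <= K * `|x - y| * `|a - b|.
Proof.
have cg : continuous (d_A (d_rho f)) by case: f2 => _ [_ [_ [_ _ []]]].
set g := d_A (d_rho f) in cg.
have : compact (g @` (`[- m, m] `*` `[- m, m])).
  apply: continuous_compact; first exact: continuous_subspaceT.
  by apply: compact_setX; exact: segment_compact.
move=> /compact_bounded[K [_ gK]].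
have {}gK r a : `|r| <= m -> `|a| <= m -> `|g (r, a)| <= `|K| + 1.
  move=> rm am; apply: gK; first by rewrite ltr_pwDr// ler_norm.
  by exists (r, a) => //; split; rewrite /= in_itv/= -ler_norml.
exists (`|K| + 1) => [|x y a b xm ym am bm]; first by rewrite addr_ge0.
have box (u v w : R) : `|u| <= m -> `|v| <= m -> Order.min u v <= w ->
    w <= Order.max u v -> `|w| <= m.
  rewrite !ler_norml => /andP[u1 u2] /andP[v1 v2] w1 w2; apply/andP; split.
    by apply: le_trans w1; rewrite le_min u1.
  by apply: le_trans w2 _; rewrite ge_max u2.
pose p r := f (r, a) - f (r, b).
have D1 r e : is_derive r (1 : R) (fun r => f (r, e)) (d_rho f (r, e)).
  by rewrite /d_rho derive1E; apply: derivableP; have [] := df (r, e).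
have dp (r : R) : is_derive r 1 p (d_rho f (r, a) - d_rho f (r, b)).
  exact: is_deriveB.
have [r [r1 r2 ->]] := @mvt_all _ p x y (fun z => @ex_derive _ _ _ _ _ _ _ (dp z)).
rewrite derive1E (@derive_val _ _ _ _ _ _ _ (dp r)).
have [s [s1 s2 ->]] := @mvt_all _ (fun e => d_rho f (r, e)) a b
  (fun z => (dfr (r, z)).2).
rewrite normrM (mulrAC _ `|x - y|) ler_wpM2r// normrM ler_wpM2r//.
by apply: gK; [exact: box xm ym r1 r2|exact: box am bm s1 s2].
Qed.

End flux_bounds.

Lemma CFL_bound (R : realType) (f : R * R -> R) (alpha lam : R) :
  flux_hyp f -> 0 < alpha -> 0 < lam -> CFL f alpha lam ->
  exists N, [/\ 0 <= N, forall p, `|d_rho f p| <= N, lam * N <= 2 / 27 &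
                lam * N <= alpha].
Proof.
move=> [[_ [_ [cf _] _]] fin _ _ _] a0 l0; rewrite /CFL.
have := Lnorm_ge0 Leb2 +oo%E (EFin \o d_rho f).
have := @le_Linfty_continuous R _ _ cf.
have : ('N[Leb2]_+oo[EFin \o d_rho f] < +oo)%E.
  by move/sub_Lfun_finLfun: fin => /set_mem.
case: ('N[Leb2]_+oo[EFin \o d_rho f])%E => [N| |]// _ fN N0.
rewrite lee_fin in N0; rewrite !le_min => /andP[/andP[_ c2] c3].
have {}fN p : `|d_rho f p| <= N by have := fN p; rewrite lee_fin.
(* for N = 0 the quotients in the CFL condition are +oo *)
exists N; have [Nz|Nz] := eqVneq N 0.
  by split => //; rewrite Nz mulr0 ?ltW// divr_ge0.
have Np : 0 < N by rewrite lt_neqAle eq_sym Nz.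
split => //.
- move: c2; rewrite -EFinM inver mulf_eq0 pnatr_eq0 (negbTE Nz)/= -EFinM.
  by rewrite lee_fin ler_pdivlMr ?mulr_gt0//; lra.
- by move: c3; rewrite inver (negbTE Nz) -EFinM lee_fin ler_pdivlMr.
Qed.

(** * Positivity and conservation of mass *)

Section slopes.
Context {R : realType}.
Implicit Types (a b c : R) (rho : int -> R).

Lemma fraction_of a m : 0 <= m <= a \/ a <= m <= 0 ->
  exists2 t, 0 <= t <= 1 & m = t * a.
Proof.
have [->|a0] := eqVneq a 0.
  move=> h; exists 0; first by rewrite lexx ler01.
  by rewrite mul0r; apply/eqP; rewrite eq_le; case: h => /andP[-> ->].
move=> h; exists (m / a); last by rewrite divfK.
have {a0 h}[[a0 /andP[m0 ma]]|[a0 /andP[am m0]]] :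
    (0 < a /\ 0 <= m <= a) \/ (a < 0 /\ a <= m <= 0).
  move: a0; rewrite neq_lt => /orP[a0|a0]; [right|left]; split => //.
  - by case: h => // /andP[m0 /(le_trans m0)]; rewrite leNgt a0.
  - by case: h => // /andP[/le_trans h /h]; rewrite leNgt a0.
- by rewrite divr_ge0 ?(ltW a0)//= ler_pdivrMr// mul1r.
- by rewrite ler_ndivrMr// mul1r am andbT mulr_le0// invr_le0 (ltW a0).
Qed.

Lemma minmod3_between a b c :
  (0 <= minmod3 a b c <= a \/ a <= minmod3 a b c <= 0) /\
  (0 <= minmod3 a b c <= c \/ c <= minmod3 a b c <= 0).
Proof.
rewrite /minmod3; case: ifPn => [/and3P[/ltW a0 /ltW b0 /ltW c0]|_].
  by split; left; rewrite !le_min a0 b0 c0 !ge_min !lexx ?orbT.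
case: ifPn => [/and3P[/ltW a0 /ltW b0 /ltW c0]|_].
  by split; right; rewrite !ge_max a0 b0 c0 !le_max !lexx ?orbT.
have trivial_between (x : R) : 0 <= (0 : R) <= x \/ x <= (0 : R) <= 0.
  by rewrite lexx andbT; apply/orP; exact: le_total.
by split.
Qed.

Context {theta : R} (theta_bounds : 0 <= theta <= 1 / 2).

(** Minmod lies between 0 and each of its arguments, and [2 * theta <= 1]. *)
Lemma slope_fractions rho j :
  (exists2 s, 0 <= s <= 1 & slope theta rho j = s * (rho j - rho (j - 1))) /\
  (exists2 t, 0 <= t <= 1 & slope theta rho j = t * (rho (j + 1) - rho j)).
Proof.
rewrite /slope; have [/fraction_of[s s01 e1] /fraction_of[t t01 e2]] :=
  minmod3_between (rho j - rho (j - 1)) ((rho (j + 1) - rho (j - 1)) / 2)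
                  (rho (j + 1) - rho j).
have scale (u : R) : 0 <= u <= 1 -> 0 <= 2 * theta * u <= 1.
  by move: theta_bounds; nra.
split; [exists (2 * theta * s)|exists (2 * theta * t)]; rewrite ?scale//.
- by rewrite e1 mulrA.
- by rewrite e2 mulrA.
Qed.

Lemma slope_le rho j : (forall i, 0 <= rho i) ->
  - rho j <= slope theta rho j <= rho j.
Proof.
move=> r0; have [[s s01 e1] [t t01 e2]] := slope_fractions rho j.
have p := r0 j; have p1 := r0 (j - 1); have p2 := r0 (j + 1).
by apply/andP; split; [rewrite e2|rewrite e1]; nra.
Qed.

Lemma face_value_bounds rho j : (forall i, 0 <= rho i) ->
  rho j / 2 <= rho_r theta rho j <= 3 / 2 * rho j /\
  rho j / 2 <= rho_l theta rho j <= 3 / 2 * rho j.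
Proof. by move=> /slope_le => /(_ j); rewrite /rho_r /rho_l; lra. Qed.

End slopes.

Section mass.
Context {R : realType} (f : R * R -> R) (mu : R -> R).
Context (theta alpha dx dt N : R).
Local Notation lam := (dt / dx).
Context (theta_bounds : 0 <= theta <= 1 / 2) (alpha_bounds : 0 < alpha < 8 / 27).
Context (dx_gt0 : 0 < dx) (dt_gt0 : 0 < dt).
Context (cfl1 : lam * N <= 2 / 27) (cfl2 : lam * N <= alpha).
Context (f0 : forall a, f (0, a) = 0).
Context (f_lip : forall x y a, `|f (x, a) - f (y, a)| <= N * `|x - y|).
Context (rho : int -> R) (rho_ge0 : forall j, 0 <= rho j).

Local Notation mid_r := (mid_r f mu theta dx dt rho).
Local Notation mid_l := (mid_l f mu theta dx dt rho).
Local Notation mid_conv := (mid_conv f mu theta dx dt rho).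
Local Notation delta := (delta f mu theta dx rho).
Local Notation update := (update f mu theta alpha dx dt rho).

Let lam_gt0 : 0 < lam. Proof. exact: divr_gt0. Qed.

Lemma flux_le x a : 0 <= x -> `|f (x, a)| <= N * x.
Proof. by move=> x0; have := f_lip x 0 a; rewrite f0 !subr0 (ger0_norm x0). Qed.

Lemma lam_flux_le x a : 0 <= x -> `|lam * f (x, a)| <= lam * N * x.
Proof.
by move=> x0; rewrite normrM gtr0_norm// -(mulrA lam) ler_wpM2l ?flux_le// ltW.
Qed.

Lemma lam_delta_le j : `|lam * delta j| <= 2 * (lam * N) * rho j.
Proof.
have [/andP[r1 r2] /andP[l1 l2]] := face_value_bounds theta_bounds j rho_ge0.
have rj := rho_ge0 j.
rewrite /Defs.delta mulrBr; apply: le_trans (ler_normB _ _) _.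
apply: le_trans (lerD (lam_flux_le _ _) (lam_flux_le _ _)) _; try lra.
by rewrite -mulrDr /rho_r /rho_l; lra.
Qed.

Lemma mid_value_bounds j :
  [/\ 0 <= mid_r j <= 2 * rho j, 0 <= mid_l j <= 2 * rho j &
      mid_r j + mid_l j <= 58 / 27 * rho j].
Proof.
have [/andP[r1 r2] /andP[l1 l2]] := face_value_bounds theta_bounds j rho_ge0.
have rj := rho_ge0 j; have := lam_delta_le j; rewrite ler_norml => /andP[d1 d2].
have c : lam * N * rho j <= 2 / 27 * rho j by rewrite ler_wpM2r.
have e : lam / 2 * delta j = lam * delta j / 2 by rewrite mulrAC.
rewrite /Defs.mid_r /Defs.mid_l e.
by split; rewrite /rho_r /rho_l in r1 r2 l1 l2 *; lra.
Qed.

Definition outflow_r j :=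
  alpha / 2 * mid_r j + lam / 2 * f (mid_r j, mid_conv j).
Definition outflow_l j :=
  alpha / 2 * mid_l j - lam / 2 * f (mid_l j, mid_conv (j - 1)).

(** The numerical flux is a sum of two terms, each of which involves the trace of
    one cell only. Grouped by that cell, the update becomes an exchange: cell [j]
    sends [outflow_r j] to its right neighbour and [outflow_l j] to the left. *)
Lemma update_exchange j : update j =
  (rho j - outflow_r j - outflow_l j) + outflow_r (j - 1) + outflow_l (j + 1).
Proof.
rewrite /Defs.update /face_flux /num_flux /outflow_r /outflow_l.
rewrite (subrK 1 j) (addrK 1 j).
field.
by rewrite !lt0r_neq0.
Qed.

Let half_bound (m y : R) : 0 <= m -> `|lam * y| <= lam * N * m ->
  [/\ 0 <= alpha / 2 * m + lam / 2 * y, 0 <= alpha / 2 * m - lam / 2 * y,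
      alpha / 2 * m + lam / 2 * y <= 4 / 27 * m + lam * N * m / 2 &
      alpha / 2 * m - lam / 2 * y <= 4 / 27 * m + lam * N * m / 2].
Proof.
move=> m0; rewrite ler_norml => /andP[y1 y2].
have e : lam / 2 * y = lam * y / 2 by rewrite mulrAC.
have c : lam * N * m <= alpha * m by rewrite ler_wpM2r.
have c' : alpha * m <= 8 / 27 * m.
  by rewrite ler_wpM2r//; case/andP: alpha_bounds => _ /ltW.
by rewrite e; split; lra.
Qed.

(** By the CFL condition and [f (0, a) = 0], the flux at a density [x] is at most
    [alpha / lam * x], so the viscosity dominates it and no outflow is negative;
    the two outflows together take less than the content of the cell. *)
Lemma outflow_bounds j : [/\ 0 <= outflow_r j, 0 <= outflow_l j &
  0 <= rho j - outflow_r j - outflow_l j].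
Proof.
have [/andP[r1 r2] /andP[l1 l2] rl] := mid_value_bounds j.
have [p1 _ p2 _] := half_bound r1 (lam_flux_le (mid_conv j) r1).
have [_ q1 _ q2] := half_bound l1 (lam_flux_le (mid_conv (j - 1)) l1).
split => //.
have cr : lam * N * mid_r j <= 2 / 27 * mid_r j by rewrite ler_wpM2r.
have cl : lam * N * mid_l j <= 2 / 27 * mid_l j by rewrite ler_wpM2r.
by rewrite /outflow_r /outflow_l; have := rho_ge0 j; lra.
Qed.

Lemma update_ge0 j : 0 <= update j.
Proof.
rewrite update_exchange; have [_ _ a] := outflow_bounds j.
have [b _ _] := outflow_bounds (j - 1); have [_ c _] := outflow_bounds (j + 1).
exact: addr_ge0 (addr_ge0 a b) c.
Qed.

Lemma bisum_update : bisum update = bisum rho.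
Proof.
rewrite (eq_bisum update_exchange).
rewrite (@bisum_exchange R (fun j => rho j - outflow_r j - outflow_l j)).
- by apply: eq_bisum => j; ring.
- by move=> j; have [] := outflow_bounds j.
- by move=> j; have [] := outflow_bounds j.
- by move=> j; have [] := outflow_bounds j.
Qed.

End mass.

(** * Regularity of the convolutions *)

Section convolution.
Context {R : realType} (mu : R -> R) (dx m0 m1 m2 B : R).
Context (dx_gt0 : 0 < dx) (mu_supp : forall x, B < `|x| -> mu x = 0).
Context (mu0 : forall x, `|mu x| <= m0).
Context (mu1 : forall x h, `|mu (x + h) - mu x| <= m1 * `|h|).
Context (mu2 : forall x h,
  `|mu (x + h) - 2 * mu x + mu (x - h)| <= m2 * h ^+ 2).

Definition kernel_weight (j l : int) : R := mu (cell_center dx (j - l)).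

Lemma fin_kernel_weight j : fin_weight (kernel_weight j).
Proof.
pose n := (Num.truncn (B / dx)).+1.
apply: (@sub_finite_set _ _ ((fun i : nat => j - Posz i) @` `I_n `|`
                             (fun i : nat => j + Posz i) @` `I_n)); last first.
  by rewrite finite_setU; split; apply: finite_image; exact: finite_II.
move=> l /= wl.
have kn : (`|(j - l)%R|%N < n)%N.
  rewrite -(ltr_nat R); apply: le_lt_trans (truncnS_gt _).
  rewrite ler_pdivlMr// natr_absz intr_norm -[dx in _ * dx]gtr0_norm// -normrM.
  by rewrite leNgt; apply: contraNN wl => h; apply/eqP; exact: mu_supp.
have [k0|k0] := leP 0 (j - l); [left|right]; exists `|(j - l)%R|%N => //=.
- by rewrite gez0_abs// opprB addrC subrK.
- by rewrite ltz0_abs// opprB addrC subrK.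
Qed.

Context (u : int -> R) (S : R) (u_ge0 : forall j, 0 <= u j).
Context (u_mass : (bisum u <= S%:E)%E).
Local Notation conv j := (wsum (kernel_weight j) u).

Let center_next j l :
  cell_center dx (j + 1 - l) = cell_center dx (j - l) + dx.
Proof. by rewrite /cell_center addrAC intrD mulrDl mul1r. Qed.

Let center_prev j l :
  cell_center dx (j - 1 - l) = cell_center dx (j - l) - dx.
Proof. by rewrite /cell_center addrAC intrB mulrBl mul1r. Qed.

Lemma conv_le j : `|conv j| <= m0 * S.
Proof. by apply: wsum_le => // [|l]; [exact: fin_kernel_weight|exact: mu0]. Qed.

(** Differences in space fall on the kernel and not on the density, whose mass
    alone enters: convolutions are smooth at the scale of the mesh. *)
Lemma conv_step j : `|conv (j + 1) - conv j| <= m1 * dx * S.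
Proof.
rewrite -wsumBl; [|exact: fin_kernel_weight..].
apply: wsum_le => // [|l]; first by apply: fin_weightB; exact: fin_kernel_weight.
by rewrite /kernel_weight center_next -[X in _ * X](gtr0_norm dx_gt0).
Qed.

Lemma conv_step2 j :
  `|conv (j + 1) - 2 * conv j + conv (j - 1)| <= m2 * dx ^+ 2 * S.
Proof.
have -> : conv (j + 1) - 2 * conv j + conv (j - 1) =
    (conv (j + 1) - conv j) - (conv j - conv (j - 1)) by ring.
have fin := fin_kernel_weight.
rewrite -!wsumBl//; try exact: fin_weightB.
apply: wsum_le => // [|l]; first by do 2!apply: fin_weightB.
rewrite /kernel_weight center_next center_prev opprB addrA.
by apply: le_trans (mu2 (cell_center dx (j - l)) dx); rewrite le_eqVlt;
   apply/orP; left; apply/eqP; congr `|_|; ring.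
Qed.

End convolution.

(** What the one-step estimates use of two families of nonlocal states, such as
    those of the two sides of a cell: values in a bounded box, first differences
    of the order of the mesh size, and a gap that changes from one index to the
    next by the order of its square only. *)
Definition close_states {R : realType} (dx A c1 c2 : R) (a b : int -> R) :=
  forall j, [/\ `|a j| <= A, `|b j| <= A, `|a j - b j| <= c1 * dx,
    `|a (j + 1) - a j| <= c1 * dx &
    `|(a (j + 1) - b (j + 1)) - (a j - b j)| <= c2 * dx ^+ 2].

Section nonlocal_states.
Context {R : realType} (f : R * R -> R) (mu : R -> R).
Context (theta alpha dx dt N m0 m1 m2 B L : R).
Local Notation lam := (dt / dx).
Context (theta_bounds : 0 <= theta <= 1 / 2).
Context (dx_gt0 : 0 < dx) (dt_gt0 : 0 < dt).
Context (cfl1 : lam * N <= 2 / 27).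
Context (f0 : forall a, f (0, a) = 0).
Context (f_lip : forall x y a, `|f (x, a) - f (y, a)| <= N * `|x - y|).
Context (mu_supp : forall x, B < `|x| -> mu x = 0).
Context (mu0 : forall x, `|mu x| <= m0).
Context (mu1 : forall x h, `|mu (x + h) - mu x| <= m1 * `|h|).
Context (mu2 : forall x h,
  `|mu (x + h) - 2 * mu x + mu (x - h)| <= m2 * h ^+ 2).
Context (rho : int -> R) (rho_ge0 : forall j, 0 <= rho j).
Context (rho_mass : (bisum rho <= (L / dx)%:E)%E).

Let w := kernel_weight mu dx.
Let fin_w j : fin_weight (w j).
Proof. exact: (@fin_kernel_weight R mu dx B). Qed.

Local Notation A j := (conv_c mu dx rho j).

Let A_le j : `|A j| <= m0 * L.
Proof.
have := conv_le dx_gt0 mu_supp mu0 rho_ge0 rho_mass j.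
rewrite /conv_c normrM (gtr0_norm dx_gt0) => h.
apply: le_trans (ler_wpM2l (ltW dx_gt0) h) _.
by rewrite mulrCA [dx * _]mulrC divfK ?gt_eqF.
Qed.

Let A_step j : `|A (j + 1) - A j| <= m1 * L * dx.
Proof.
have := conv_step dx_gt0 mu_supp mu1 rho_ge0 rho_mass j.
rewrite /conv_c -mulrBr normrM (gtr0_norm dx_gt0) => h.
apply: le_trans (ler_wpM2l (ltW dx_gt0) h) _.
rewrite le_eqVlt; apply/orP; left; apply/eqP; field; exact: lt0r_neq0.
Qed.

Let A_step2 j : `|A (j + 1) - 2 * A j + A (j - 1)| <= m2 * L * dx ^+ 2.
Proof.
have := conv_step2 dx_gt0 mu_supp mu2 rho_ge0 rho_mass j.
rewrite /conv_c (mulrCA 2) -mulrBr -mulrDr normrM (gtr0_norm dx_gt0) => h.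
apply: le_trans (ler_wpM2l (ltW dx_gt0) h) _.
rewrite le_eqVlt; apply/orP; left; apply/eqP; field; exact: lt0r_neq0.
Qed.

Lemma close_face_conv : close_states dx (2 * (m0 * L)) (2 * (m1 * L))
  (2 * (m2 * L)) (conv_r mu theta dx rho) (conv_l mu theta dx rho).
Proof.
move=> j; rewrite /conv_r /conv_l /conv_slope.
have th (x y c : R) : `|x| <= c -> `|y| <= c -> - c <= theta * (x + y) <= c.
  by rewrite !ler_norml; move: theta_bounds; nra.
have th0 (x y c : R) : `|x| <= c -> `|y| <= c -> - c <= theta * (x - y) <= c.
  by move=> xc yc; apply: th; rewrite ?normrN.
have a1 := A_le j; have a2 := A_le (j + 1); have a3 := A_le (j - 1).
have s1 := A_step j; have s2 := A_step (j - 1); have s3 := A_step (j + 1).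
have d1 := A_step2 j; have d2 := A_step2 (j + 1).
rewrite (subrK 1 j) in s2; rewrite (addrK 1 j) in d2 *.
have t1 := th0 _ _ _ a2 a3.
have t2 := th _ _ _ s1 s2.
have t3 := th _ _ _ s3 s1.
have t4 := th _ _ _ d2 d1.
move: a1 s1 a2; rewrite !ler_norml => /andP[a1 a1'] /andP[s1 s1'] /andP[a2 a2'].
case/andP: t1 => t1 t1'; case/andP: t2 => t2 t2'.
case/andP: t3 => t3 t3'; case/andP: t4 => t4 t4'.
split; lra.
Qed.

Local Notation mid_r := (mid_r f mu theta dx dt rho).
Local Notation mid_l := (mid_l f mu theta dx dt rho).

Let mid_mass (u : int -> R) : (forall j, 0 <= u j <= 2 * rho j) ->
  (bisum u <= (2 * (L / dx))%:E)%E.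
Proof.
move=> u2; apply: (@le_trans _ _ (bisum (fun j => 2 * rho j))).
  by apply: le_bisum => j; have /andP[] := u2 j.
exact: bisumZ_le.
Qed.

Lemma mid_convE j : mid_conv f mu theta dx dt rho j =
  dx / 2 * (wsum (w (j + 1)) mid_l + wsum (w j) mid_r).
Proof. by rewrite -wsum_pair. Qed.

Lemma close_mid_conv : close_states dx (2 * (m0 * L)) (2 * (m1 * L))
  (2 * (m2 * L)) (mid_conv f mu theta dx dt rho)
  (fun j => mid_conv f mu theta dx dt rho (j - 1)).
Proof.
have bd j := mid_value_bounds mu theta_bounds dx_gt0 dt_gt0 cfl1 f0
  f_lip rho_ge0 j.
have l2 j : 0 <= mid_l j <= 2 * rho j by case: (bd j).
have r2 j : 0 <= mid_r j <= 2 * rho j by case: (bd j).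
have lS := mid_mass l2; have rS := mid_mass r2.
have {l2} l0 j : 0 <= mid_l j by case/andP: (l2 j).
have {r2} r0 j : 0 <= mid_r j by case/andP: (r2 j).
have scale (x y c k : R) : `|x| <= c * (2 * (L / dx)) ->
    `|y| <= c * (2 * (L / dx)) -> dx * (c * (2 * (L / dx))) = k ->
    `|dx / 2 * (x + y)| <= k.
  move=> xc yc <-; rewrite normrM ger0_norm ?divr_ge0 ?(ltW dx_gt0)//.
  apply: le_trans (ler_wpM2l _ (le_trans (ler_normD _ _) (lerD xc yc))) _.
    by rewrite divr_ge0 ?(ltW dx_gt0).
  by rewrite le_eqVlt; apply/orP; left; apply/eqP; field; exact: lt0r_neq0.
have dx0 := lt0r_neq0 dx_gt0.
have sup j : `|mid_conv f mu theta dx dt rho j| <= 2 * (m0 * L).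
  rewrite mid_convE; apply: scale (conv_le dx_gt0 mu_supp mu0 l0 lS _)
    (conv_le dx_gt0 mu_supp mu0 r0 rS _) _.
  by field.
have step j : `|mid_conv f mu theta dx dt rho (j + 1) -
    mid_conv f mu theta dx dt rho j| <= 2 * (m1 * L) * dx.
  rewrite !mid_convE -mulrBr opprD addrACA.
  apply: scale (conv_step dx_gt0 mu_supp mu1 l0 lS _)
    (conv_step dx_gt0 mu_supp mu1 r0 rS _) _.
  by field.
move=> j; split => //.
- by have := step (j - 1); rewrite (subrK 1 j).
- rewrite (addrK 1 j) !mid_convE (subrK 1 j).
  have := conv_step2 dx_gt0 mu_supp mu2 l0 lS (j + 1).
  have := conv_step2 dx_gt0 mu_supp mu2 r0 rS j.
  rewrite (addrK 1 j) => cr cl.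
  have key := scale _ _ _ (2 * (m2 * L) * dx ^+ 2) cl cr.
  apply: le_trans (key _); last by field.
  by rewrite le_eqVlt; apply/orP; left; apply/eqP; congr `|_|; ring.
Qed.

End nonlocal_states.

(** * One time step in incremental form *)

Section gap.
Context {R : realType} (f : R * R -> R) (N M K m h c1 c2 : R).
Context (M_ge0 : 0 <= M) (K_ge0 : 0 <= K).
Context (f_lip : forall x y a, `|f (x, a) - f (y, a)| <= N * `|x - y|).
Context (f_lipA : forall x a b, `|f (x, a) - f (x, b)| <= M * `|x| * `|a - b|).
Context (f_incA : forall x a b c d,
  `|(f (x, a) - f (x, b)) - (f (x, c) - f (x, d))| <=
    M * `|x| * `|(a - b) - (c - d)|
    + M * `|x| * (`|a - c| + `|a - b| + `|c - d|) * `|c - d|).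
Context (f_mix : forall x y a b,
  `|x| <= m -> `|y| <= m -> `|a| <= m -> `|b| <= m ->
  `|(f (x, a) - f (x, b)) - (f (y, a) - f (y, b))| <= K * `|x - y| * `|a - b|).
Implicit Types x y a b c d : R.

Lemma gap_le x a b : 0 <= x -> `|a - b| <= c1 * h ->
  `|f (x, a) - f (x, b)| <= M * c1 * h * x.
Proof.
move=> x0 ab; apply: le_trans (f_lipA _ _ _) _; rewrite (ger0_norm x0).
by apply: le_trans (ler_wpM2l _ ab) _; rewrite ?mulr_ge0//; lra.
Qed.

(** With no factor [h] in front of the jump of the density, but without mixed
    derivatives either: this serves to compare the mid-time traces of
    neighbouring cells, uniformly in the mesh size. *)
Lemma gap_step_crude x y a b c d : 0 <= y ->
  `|a - b| <= c1 * h -> `|c - d| <= c1 * h ->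
  `|(f (x, a) - f (x, b)) - (f (y, c) - f (y, d))| <=
    2 * N * `|x - y| + 2 * (M * c1 * h * y).
Proof.
move=> y0 ab cd.
have := gap_le y0 ab; have := gap_le y0 cd.
have := f_lip x y a; have := f_lip x y b; rewrite !ler_norml; lra.
Qed.

(** Moving the density costs the mixed derivative times a gap of order [h];
    moving the pair of states costs [M * y] times a quantity of order [h ^ 2],
    which is summable against the mass. *)
Lemma gap_step x y a b c d : `|x| <= m -> 0 <= y <= m -> `|a| <= m -> `|b| <= m ->
  `|a - b| <= c1 * h -> `|c - d| <= c1 * h -> `|a - c| <= c1 * h ->
  `|(a - b) - (c - d)| <= c2 * h ^+ 2 ->
  `|(f (x, a) - f (x, b)) - (f (y, c) - f (y, d))| <=
    K * c1 * h * `|x - y| + M * (c2 + 3 * c1 ^+ 2) * h ^+ 2 * y.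
Proof.
move=> xm /andP[y0 ym] am bm ab cd ac abcd.
have -> : (f (x, a) - f (x, b)) - (f (y, c) - f (y, d)) =
  ((f (x, a) - f (x, b)) - (f (y, a) - f (y, b))) +
  ((f (y, a) - f (y, b)) - (f (y, c) - f (y, d))) by ring.
apply: le_trans (ler_normD _ _) _; apply: lerD.
  apply: le_trans (f_mix xm _ am bm) _; first by rewrite ger0_norm.
  by apply: le_trans (ler_wpM2l _ ab) _; rewrite ?mulr_ge0//; lra.
apply: le_trans (f_incA _ _ _ _ _) _; rewrite (ger0_norm y0).
have My : 0 <= M * y by rewrite mulr_ge0.
have -> : M * (c2 + 3 * c1 ^+ 2) * h ^+ 2 * y =
  M * y * (c2 * h ^+ 2) + M * y * ((3 * (c1 * h)) * (c1 * h)) by ring.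
apply: lerD; first exact: ler_wpM2l.
rewrite -(mulrA (M * y)); apply: ler_wpM2l => //.
by apply: ler_pM; rewrite ?addr_ge0//; lra.
Qed.

End gap.

Section incremental_form.
Context {R : realType} (f : R * R -> R) (mu : R -> R).
Context (theta alpha dx dt N : R).
Local Notation lam := (dt / dx).
Context (theta_bounds : 0 <= theta <= 1 / 2) (alpha_bounds : 0 < alpha < 8 / 27).
Context (dx_gt0 : 0 < dx) (dt_gt0 : 0 < dt).
Context (cfl1 : lam * N <= 2 / 27) (cfl2 : lam * N <= alpha).
Context (f_lip : forall x y a, `|f (x, a) - f (y, a)| <= N * `|x - y|).
Context (rho : int -> R).

Local Notation mid_r := (mid_r f mu theta dx dt rho).
Local Notation mid_l := (mid_l f mu theta dx dt rho).
Local Notation mid_conv := (mid_conv f mu theta dx dt rho).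
Local Notation delta := (delta f mu theta dx rho).
Local Notation update := (update f mu theta alpha dx dt rho).

Let lam_gt0 : 0 < lam. Proof. exact: divr_gt0. Qed.

(** A quotient by 0 is 0, so [flux_quotientE] covers [x = y] too. *)
Definition flux_quotient x y a := (f (x, a) - f (y, a)) / (x - y).

Lemma flux_quotientE x y a :
  f (x, a) - f (y, a) = flux_quotient x y a * (x - y).
Proof.
have [->|xy] := eqVneq x y; first by rewrite !subrr mulr0.
by rewrite divfK// subr_eq0.
Qed.

Lemma lam_flux_quotient_le x y a (c : R) : lam * N <= c -> 0 <= c ->
  - c <= lam * flux_quotient x y a <= c.
Proof.
move=> Nc c0; rewrite -ler_norml /flux_quotient.
have [->|xy] := eqVneq x y; first by rewrite !subrr mul0r mulr0 normr0.
rewrite normrM gtr0_norm// normrM normfV; apply: le_trans Nc.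
by rewrite ler_wpM2l ?(ltW lam_gt0)// ler_pdivrMr ?normr_gt0 ?subr_eq0.
Qed.

Definition face_gap j :=
  f (rho_l theta rho j, conv_r mu theta dx rho j) -
  f (rho_l theta rho j, conv_l mu theta dx rho j).
Definition right_gap j :=
  f (mid_r (j - 1), mid_conv j) - f (mid_r (j - 1), mid_conv (j - 1)).
Definition left_gap j :=
  f (mid_l j, mid_conv j) - f (mid_l j, mid_conv (j - 1)).

Lemma deltaE j : delta j = 
  flux_quotient (rho_r theta rho j) (rho_l theta rho j) (conv_r mu theta dx rho j)
    * slope theta rho j + face_gap j.
Proof.
have -> : slope theta rho j = rho_r theta rho j - rho_l theta rho j.
  by rewrite /rho_r /rho_l; field.
by rewrite -flux_quotientE /Defs.delta /face_gap; ring.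
Qed.

(** Up to the gaps, a jump between mid-time traces is a nonnegative multiple of
    the jump of the averages: the slopes of the two cells are fractions of that
    jump, and each corrects it by at most [(1 + 2 / 27) / 2 = 29 / 54] of it, the
    term [2 / 27] coming from the half step in time. *)
Lemma mid_steps j : exists k, [/\ 0 <= k.1 <= 83 / 54, 0 <= k.2 <= 83 / 54,
  mid_r (j + 1) - mid_r j =
    k.1 * (rho (j + 1) - rho j) - lam / 2 * (face_gap (j + 1) - face_gap j) &
  mid_l (j + 1) - mid_l j =
    k.2 * (rho (j + 1) - rho j) - lam / 2 * (face_gap (j + 1) - face_gap j)].
Proof.
have [[s s01 es] _] := slope_fractions theta_bounds rho (j + 1).
have [_ [t t01 et]] := slope_fractions theta_bounds rho j.
rewrite (addrK 1 j) in es.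
rewrite /Defs.mid_r /Defs.mid_l !deltaE.
have c0 : (0 : R) <= 2 / 27 by lra.
set g := flux_quotient _ _ _; set g' := flux_quotient _ _ _.
have := lam_flux_quotient_le _ _ _ cfl1 c0 : - (2 / 27) <= lam * g <= 2 / 27.
have := lam_flux_quotient_le _ _ _ cfl1 c0 : - (2 / 27) <= lam * g' <= 2 / 27.
set u := lam * g; set u' := lam * g' => u'b ub.
have prod (x y : R) : 0 <= x <= 1 -> - (2 / 27) <= y <= 2 / 27 ->
    [/\ 0 <= x / 2 * (1 - y) <= 29 / 54 & 0 <= x / 2 * (1 + y) <= 29 / 54].
  by move=> /andP[x0 x1] /andP[y0 y1]; split; nra.
have [sm sp] := prod _ _ s01 ub; have [tm tp] := prod _ _ t01 u'b.
exists (1 + s / 2 * (1 - u) - t / 2 * (1 - u'),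
        1 - s / 2 * (1 + u) + t / 2 * (1 + u')); split => /=.
- lra.
- lra.
- by rewrite /rho_r es et /u /u'; field; exact: lt0r_neq0.
- by rewrite /rho_l es et /u /u'; field; exact: lt0r_neq0.
Qed.

(** Harten's incremental form. The coefficients are at most
    [8 / 27 * (83 / 54) < 1 / 2], which makes the incremental part a convex
    combination of three neighbouring averages; the error [e] collects what the
    variation of the nonlocal states adds. *)
Lemma harten_form : exists C D e : int -> R,
  [/\ forall j, 0 <= C j <= 1 / 2, forall j, 0 <= D j <= 1 / 2,
      forall j, update j = rho j - C j * (rho j - rho (j - 1))
                           + D j * (rho (j + 1) - rho j) + e j,
      forall j, `|e j| <= lam / 2 *
        (`|face_gap j - face_gap (j - 1)| + `|face_gap (j + 1) - face_gap j|
         + `|right_gap j| + `|left_gap j|) &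
      forall j, `|e (j + 1) - e j| <= lam / 2 *
        (`|face_gap (j + 1) - face_gap j|
         + `|face_gap (j + 1 + 1) - face_gap (j + 1)|
         + `|face_gap j - face_gap (j - 1)| + `|face_gap (j + 1) - face_gap j|
         + `|right_gap (j + 1) - right_gap j| + `|left_gap (j + 1) - left_gap j|)].
Proof.
have [k kP] := choice mid_steps.
(* the factors of the jumps of the right traces and of the left traces *)
pose p j :=
  (alpha + lam * flux_quotient (mid_r j) (mid_r (j - 1)) (mid_conv j)) / 2.
pose q j :=
  (alpha - lam * flux_quotient (mid_l (j + 1)) (mid_l j) (mid_conv j)) / 2.
have a0 : 0 <= alpha by case/andP: alpha_bounds => /ltW.
have a1 : alpha <= 8 / 27 by case/andP: alpha_bounds => _ /ltW.
have pb j : 0 <= p j <= 8 / 27.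
  have := lam_flux_quotient_le (mid_r j) (mid_r (j - 1)) (mid_conv j) cfl2 a0.
  by rewrite /p; lra.
have qb j : 0 <= q j <= 8 / 27.
  have := lam_flux_quotient_le (mid_l (j + 1)) (mid_l j) (mid_conv j) cfl2 a0.
  by rewrite /q; lra.
pose E j := face_gap (j + 1) - face_gap j.
have E1 j : E (j - 1) = face_gap j - face_gap (j - 1) by rewrite /E (subrK 1 j).
pose e j := lam / 2 * (p j * E (j - 1) - q j * E j - (right_gap j + left_gap j)).
exists (fun j => p j * (k (j - 1)).1), (fun j => q j * (k j).2), e.
have half (x y : R) : 0 <= x <= 8 / 27 -> 0 <= y <= 83 / 54 ->
    0 <= x * y <= 1 / 2.
  by move=> /andP[x0 x1] /andP[y0 y1]; nra.
have frac (x y : R) : 0 <= x <= 8 / 27 -> `|x * y| <= `|y|.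
  move=> /andP[x0 x1]; rewrite normrM (ger0_norm x0) ler_piMl//; lra.
have nb (x : R) : - `|x| <= x <= `|x| by rewrite -ler_norml.
have tri (x y z w : R) : `|x - y - (z + w)| <= `|x| + `|y| + `|z| + `|w|.
  have := nb x; have := nb y; have := nb z; have := nb w.
  by rewrite ler_norml; lra.
have tri2 (x y z w x' y' z' w' : R) :
    `|(x - y - (z + w)) - (x' - y' - (z' + w'))| <=
    `|x| + `|y| + `|x'| + `|y'| + `|z - z'| + `|w - w'|.
  have := nb x; have := nb y; have := nb x'; have := nb y'.
  by have := nb (z - z'); have := nb (w - w'); rewrite ler_norml; lra.
have l2 : 0 <= lam / 2 by rewrite divr_ge0 ?(ltW lam_gt0).
split => j.
- by apply: half => //; case: (kP (j - 1)).
- by apply: half => //; case: (kP j).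
- have [_ _ kr _] := kP (j - 1); have [_ _ _ kl] := kP j.
  rewrite (subrK 1 j) in kr.
  have upd : update j = rho j - p j * (mid_r j - mid_r (j - 1))
      + q j * (mid_l (j + 1) - mid_l j) - lam / 2 * (right_gap j + left_gap j).
    have P : f (mid_r j, mid_conv j) = _ :=
      canRL (subrK _) (flux_quotientE (mid_r j) (mid_r (j - 1)) (mid_conv j)).
    have Q : f (mid_l (j + 1), mid_conv j) = _ :=
      canRL (subrK _) (flux_quotientE (mid_l (j + 1)) (mid_l j) (mid_conv j)).
    rewrite /Defs.update /face_flux /num_flux (subrK 1 j) /p /q.
    rewrite /right_gap /left_gap P Q.
    by field; rewrite !lt0r_neq0.
  rewrite upd kr kl /e E1 /E; ring.
- rewrite /e normrM (ger0_norm l2) ler_wpM2l// -E1.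
  apply: le_trans (tri _ _ _ _) _; rewrite !lerD//; exact: frac.
- rewrite /e -mulrBr normrM (ger0_norm l2) ler_wpM2l//.
  rewrite (addrK 1 j) -E1 -/(E j) -/(E (j + 1)).
  apply: le_trans (tri2 _ _ _ _ _ _ _ _) _.
  by rewrite !lerD//; exact: frac.
Qed.

End incremental_form.

(** * Growth of the maximum and of the total variation in one step *)

(** In one step of length [dt], a jump [d] produces at most [3 * tv_rate * dt * d]
    of new variation, and a mass [L] at most [3 * tv_source * L * dt]; see
    [bisum_jump_update]. *)
Definition tv_rate {R : realType} (K c1 : R) := 3 * K * c1.
Definition tv_source {R : realType} (l K M c1 c2 : R) :=
  2 * l * K * M * c1 ^+ 2 + 2 * M * (c2 + 3 * c1 ^+ 2).

Section one_step.
Context {R : realType} (f : R * R -> R) (mu : R -> R).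
Context (theta alpha dx dt N M m0 m1 m2 B L : R).
Local Notation lam := (dt / dx).
Context (theta_bounds : 0 <= theta <= 1 / 2) (alpha_bounds : 0 < alpha < 8 / 27).
Context (dx_gt0 : 0 < dx) (dt_gt0 : 0 < dt) (N_ge0 : 0 <= N) (M_ge0 : 0 <= M).
Context (m1_ge0 : 0 <= m1) (L_ge0 : 0 <= L).
Context (cfl1 : lam * N <= 2 / 27) (cfl2 : lam * N <= alpha).
Context (f0 : forall a, f (0, a) = 0).
Context (f_lip : forall x y a, `|f (x, a) - f (y, a)| <= N * `|x - y|).
Context (f_lipA : forall x a b, `|f (x, a) - f (x, b)| <= M * `|x| * `|a - b|).
Context (mu_supp : forall x, B < `|x| -> mu x = 0).
Context (mu0 : forall x, `|mu x| <= m0).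
Context (mu1 : forall x h, `|mu (x + h) - mu x| <= m1 * `|h|).
Context (mu2 : forall x h,
  `|mu (x + h) - 2 * mu x + mu (x - h)| <= m2 * h ^+ 2).
Context (rho : int -> R) (rho_ge0 : forall j, 0 <= rho j).
Context (rho_mass : (bisum rho <= (L / dx)%:E)%E).

Local Notation c1 := (2 * (m1 * L)).
Local Notation c2 := (2 * (m2 * L)).
Local Notation mid_r := (mid_r f mu theta dx dt rho).
Local Notation mid_l := (mid_l f mu theta dx dt rho).
Local Notation mid_conv := (mid_conv f mu theta dx dt rho).
Local Notation update := (update f mu theta alpha dx dt rho).
Local Notation gap_face := (face_gap f mu theta dx rho).
Local Notation gap_r := (right_gap f mu theta dx dt rho).
Local Notation gap_l := (left_gap f mu theta dx dt rho).

Let c1_ge0 : 0 <= c1. Proof. by rewrite !mulr_ge0. Qed.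
Let lam_gt0 : 0 < lam. Proof. exact: divr_gt0. Qed.
Let lam_dx : lam * dx = dt. Proof. by rewrite divfK// gt_eqF. Qed.
Let face := close_face_conv theta_bounds dx_gt0 mu_supp mu0 mu1 mu2
  rho_ge0 rho_mass.
Let mid := close_mid_conv theta_bounds dx_gt0 dt_gt0 cfl1 f0 f_lip mu_supp
  mu0 mu1 mu2 rho_ge0 rho_mass.
Let face_value j := face_value_bounds theta_bounds j rho_ge0.
Let mid_value j := mid_value_bounds mu theta_bounds dx_gt0 dt_gt0 cfl1 f0 f_lip
  rho_ge0 j.

Let g_face j : `|gap_face j| <= M * c1 * dx * (3 / 2 * rho j).
Proof.
have [_ /andP[l1 l2]] := face_value j; have [_ _ ab _ _] := face j.
have l0 : 0 <= rho_l theta rho j.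
  by apply: le_trans l1; rewrite divr_ge0.
apply: le_trans (gap_le M_ge0 f_lipA l0 ab) _.
by rewrite ler_wpM2l// !mulr_ge0 ?(ltW dx_gt0).
Qed.

Let Mcd_ge0 : 0 <= M * c1 * dx.
Proof. by rewrite !mulr_ge0 ?(ltW dx_gt0). Qed.

Let g_r j : `|gap_r j| <= M * c1 * dx * (2 * rho (j - 1)).
Proof.
have [/andP[r0 r1] _ _] := mid_value (j - 1); have [_ _ ab _ _] := mid j.
by apply: le_trans (gap_le M_ge0 f_lipA r0 ab) _; rewrite ler_wpM2l.
Qed.

Let g_l j : `|gap_l j| <= M * c1 * dx * (2 * rho j).
Proof.
have [_ /andP[l0 l1] _] := mid_value j; have [_ _ ab _ _] := mid j.
by apply: le_trans (gap_le M_ge0 f_lipA l0 ab) _; rewrite ler_wpM2l.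
Qed.

(** The convex combination does not exceed [r], and all gaps are at most of the
    order of [dx * r] since [d_A f] is bounded by [M] times the density. *)
Lemma update_le (r : R) : (forall j, rho j <= r) ->
  forall j, update j <= (1 + 5 * M * c1 * dt) * r.
Proof.
move=> rho_r j.
have [C [D [e [C01 D01 upd ej _]]]] := harten_form mu theta_bounds alpha_bounds
  dx_gt0 dt_gt0 cfl1 cfl2 f_lip rho.
have cd (x y : R) : `|x| <= M * c1 * dx * (3 / 2 * r) ->
    `|y| <= M * c1 * dx * (3 / 2 * r) -> `|x - y| <= M * c1 * dx * (3 * r).
  by move=> xb yb; apply: le_trans (ler_normB _ _) _; lra.
have gf i : `|gap_face i| <= M * c1 * dx * (3 / 2 * r).
  by apply: le_trans (g_face i) _; rewrite ler_wpM2l// ler_wpM2l.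
have gr i : `|gap_r i| <= M * c1 * dx * (2 * r).
  by apply: le_trans (g_r i) _; rewrite ler_wpM2l// ler_wpM2l.
have gl i : `|gap_l i| <= M * c1 * dx * (2 * r).
  by apply: le_trans (g_l i) _; rewrite ler_wpM2l// ler_wpM2l.
have {}ej : e j <= 5 * M * c1 * dt * r.
  apply: le_trans (ler_norm _) (le_trans (ej j) _).
  have -> : 5 * M * c1 * dt * r = lam / 2 * (M * c1 * dx * (10 * r)).
    by rewrite -[in LHS]lam_dx; field; exact: lt0r_neq0.
  apply: ler_wpM2l; first by apply: divr_ge0 => //; exact: ltW.
  apply: le_trans (lerD (lerD (lerD (cd _ _ (gf j) (gf (j - 1)))
    (cd _ _ (gf (j + 1)) (gf j))) (gr j)) (gl j)) _.
  by rewrite -!mulrDr ler_wpM2l//; lra.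
have /andP[C0 C1] := C01 j; have /andP[D0 D1] := D01 j.
have conv : (1 - C j - D j) * rho j + C j * rho (j - 1) + D j * rho (j + 1) <=
    (1 - C j - D j) * r + C j * r + D j * r.
  by apply: lerD; [apply: lerD|]; apply: ler_wpM2l => //; lra.
by rewrite upd; lra.
Qed.

Context (K m : R) (K_ge0 : 0 <= K).
Context (f_incA : forall x a b c d,
  `|(f (x, a) - f (x, b)) - (f (x, c) - f (x, d))| <=
    M * `|x| * `|(a - b) - (c - d)|
    + M * `|x| * (`|a - c| + `|a - b| + `|c - d|) * `|c - d|).
Context (f_mix : forall x y a b,
  `|x| <= m -> `|y| <= m -> `|a| <= m -> `|b| <= m ->
  `|(f (x, a) - f (x, b)) - (f (y, a) - f (y, b))| <= K * `|x - y| * `|a - b|).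
Context (rho_m : forall j, 2 * rho j <= m) (conv_m : 2 * (m0 * L) <= m).
Context (m2_ge0 : 0 <= m2).

Let step_gap := @gap_step R f M K m dx c1 c2 M_ge0 K_ge0 f_incA f_mix.

Local Notation rate := (tv_rate K c1).
Local Notation source := (tv_source lam K M c1 c2).

Local Notation jump j := `|rho (j + 1) - rho j|.
Local Notation Z j := (rate * dx * jump j + source * dx ^+ 2 * rho j).

Let c2_ge0 : 0 <= c2. Proof. by rewrite !mulr_ge0. Qed.
Let dx_ge0 := ltW dx_gt0.
Let lam_ge0 := ltW lam_gt0.

Let s1_ge0 : 0 <= K * c1 * dx. Proof. by rewrite !mulr_ge0. Qed.
Let s2_ge0 : 0 <= M * (c2 + 3 * c1 ^+ 2) * dx ^+ 2.
Proof.
apply: mulr_ge0 (sqr_ge0 _); apply: mulr_ge0 => //.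
by apply: addr_ge0 => //; apply: mulr_ge0 (sqr_ge0 _).
Qed.
Let s3_ge0 : 0 <= lam * K * M * c1 ^+ 2 * dx ^+ 2.
Proof.
apply: mulr_ge0 (sqr_ge0 _); apply: mulr_ge0 (sqr_ge0 _).
by apply: mulr_ge0 => //; exact: mulr_ge0.
Qed.

Let assemble (X Y x r d : R) : 0 <= r -> 0 <= d ->
  X <= K * c1 * dx * x + M * (c2 + 3 * c1 ^+ 2) * dx ^+ 2 * Y ->
  x <= 3 * d + 2 * lam * (M * c1 * dx) * r -> Y <= 2 * r ->
  X <= rate * dx * d + source * dx ^+ 2 * r.
Proof.
move=> r0 d0 Xb xb Yb; apply: le_trans Xb _.
have := ler_wpM2l s1_ge0 xb; have := ler_wpM2l s2_ge0 Yb.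
rewrite /tv_rate /tv_source; lra.
Qed.

Let slope_jump j : `|slope theta rho j| <= jump j.
Proof.
have [_ [t /andP[t0 t1] ->]] := slope_fractions theta_bounds rho j.
by rewrite normrM (ger0_norm t0) ler_piMl.
Qed.

Let slope_jump_next j : `|slope theta rho (j + 1)| <= jump j.
Proof.
have [[t /andP[t0 t1] ->] _] := slope_fractions theta_bounds rho (j + 1).
by rewrite (addrK 1 j) normrM (ger0_norm t0) ler_piMl.
Qed.

Let face_jump j : `|rho_l theta rho (j + 1) - rho_l theta rho j| <= 2 * jump j.
Proof.
have : - jump j <= rho (j + 1) - rho j <= jump j by rewrite -ler_norml.
have := slope_jump j; have := slope_jump_next j.
rewrite /rho_l !ler_norml; lra.
Qed.

Let face_value_m j : `|rho_l theta rho j| <= m /\ 0 <= rho_l theta rho j <= m.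
Proof.
have [_ /andP[l1 l2]] := face_value j; have := rho_ge0 j; have := rho_m j.
by move=> rm r0; rewrite ger0_norm; lra.
Qed.

Let mid_value_m j : [/\ `|mid_r j| <= m, 0 <= mid_r j <= m, `|mid_l j| <= m &
  0 <= mid_l j <= m].
Proof.
have [/andP[r0 r1] /andP[l0 l1] _] := mid_value j; have rm := rho_m j.
by split; rewrite ?ger0_norm; lra.
Qed.

Let gap_face_crude j : `|gap_face (j + 1) - gap_face j| <=
  4 * N * jump j + 3 * (M * c1 * dx) * rho j.
Proof.
have [_ _ ab _ _] := face (j + 1); have [_ _ cd _ _] := face j.
have [_ /andP[l0 l1]] := face_value_m j.
have := gap_step_crude M_ge0 f_lip f_lipA (rho_l theta rho (j + 1)) l0 ab cd.
have := ler_wpM2l N_ge0 (face_jump j).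
have [_ /andP[_ l2]] := face_value j.
have := ler_wpM2l Mcd_ge0 l2.
rewrite /face_gap; lra.
Qed.

Let corr_ge0 j : 0 <= lam * (M * c1 * dx) * rho j.
Proof. exact: mulr_ge0 (mulr_ge0 lam_ge0 Mcd_ge0) (rho_ge0 j). Qed.

(* The constant 3 leaves room for 83 / 54 + 4 / 27, the second term being the
   contribution of the jump through the gap, by [gap_step_crude]. *)
Let mid_jump (y k : R) j :
  y = k * (rho (j + 1) - rho j) - lam / 2 * (gap_face (j + 1) - gap_face j) ->
  0 <= k <= 83 / 54 ->
  `|y| <= 3 * jump j + 2 * lam * (M * c1 * dx) * rho j.
Proof.
move=> -> /andP[k0 k1]; apply: le_trans (ler_normB _ _) _.
have l2 : 0 <= lam / 2 by exact: divr_ge0.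
rewrite (normrM k) (normrM (lam / 2)) (ger0_norm k0) (ger0_norm l2).
have J : 0 <= jump j by [].
have := ler_wpM2r J k1; have := ler_wpM2l lam_ge0 (gap_face_crude j).
have := ler_wpM2r J cfl1.
have := corr_ge0 j.
lra.
Qed.

Let step_face j : `|gap_face (j + 1) - gap_face j| <= Z j.
Proof.
have [a1 a2 ab ac abcd] := face (j + 1); have [_ _ cd ac' abcd'] := face j.
have [x1 _] := face_value_m (j + 1); have [_ y1] := face_value_m j.
have [_ /andP[_ l2]] := face_value j.
have rj := rho_ge0 j.
apply: assemble (rho_ge0 j) (normr_ge0 _) (step_gap x1 y1 (le_trans a1 conv_m)
  (le_trans a2 conv_m) ab cd ac' abcd') _ _; last lra.
have := corr_ge0 j.
have := face_jump j; have : 0 <= jump j by []. lra.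
Qed.

Let step_l j : `|gap_l (j + 1) - gap_l j| <= Z j.
Proof.
have [a1 a2 ab _ _] := mid (j + 1); have [_ _ cd ac' abcd'] := mid j.
have [_ _ x1 _] := mid_value_m (j + 1); have [_ _ _ y1] := mid_value_m j.
have [k [_ k2 _ kl]] := mid_steps mu theta_bounds dx_gt0 dt_gt0 cfl1
  f_lip rho j.
have [_ /andP[_ l2] _] := mid_value j.
exact: assemble (rho_ge0 j) (normr_ge0 _) (step_gap x1 y1 (le_trans a1 conv_m)
  (le_trans a2 conv_m) ab cd ac' abcd') (mid_jump kl k2) l2.
Qed.

Let step_r j : `|gap_r (j + 1) - gap_r j| <= Z (j - 1).
Proof.
have [a1 a2 ab _ _] := mid (j + 1); have [_ _ cd ac' abcd'] := mid j.
have [x1 _ _ _] := mid_value_m j; have [_ y1 _ _] := mid_value_m (j - 1).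
have [k [k1 _ kr _]] := mid_steps mu theta_bounds dx_gt0 dt_gt0 cfl1
  f_lip rho (j - 1).
have [/andP[_ r2] _ _] := mid_value (j - 1).
rewrite {1}/right_gap (addrK 1 j) in a2 ab abcd' *.
have := mid_jump kr k1; rewrite !(subrK 1 j) => mj.
exact: assemble (rho_ge0 _) (normr_ge0 _) (step_gap x1 y1 (le_trans a1 conv_m)
  (le_trans a2 conv_m) ab cd ac' abcd') mj r2.
Qed.

(** The convex part redistributes the jumps among neighbours and keeps their
    total. The six gap differences in the increment of the error are bounded by
    shifts of one sequence, whose part [dx ^ 2 * rho] sums up to [dx * L]. *)
Lemma bisum_jump_update (v : R) : (bisum (fun j => jump j) <= v%:E)%E ->
  (bisum (fun j => `|update (j + 1) - update j|)%R <=
   ((1 + 3 * rate * dt) * v + 3 * source * L * dt)%:E)%E.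
Proof.
move=> jv.
have [C [D [e [C01 D01 upd _ ej]]]] := harten_form mu theta_bounds alpha_bounds
  dx_gt0 dt_gt0 cfl1 cfl2 f_lip rho.
(* what the jump at j + 1/2 keeps, and sends to the right and to the left *)
pose X j := (1 - C (j + 1) - D j) * jump j.
pose U j := C (j + 1) * jump j.
pose V j := D j * jump j.
have rate0 : 0 <= rate * dx.
  by apply: mulr_ge0 => //; apply: mulr_ge0 => //; exact: mulr_ge0.
have source0 : 0 <= source * dx ^+ 2.
  have -> : source * dx ^+ 2 = 2 * (lam * K * M * c1 ^+ 2 * dx ^+ 2) +
    2 * (M * (c2 + 3 * c1 ^+ 2) * dx ^+ 2) by rewrite /tv_source; ring.
  by apply: addr_ge0; apply: mulr_ge0.
have Z0 j : 0 <= Z j by apply: addr_ge0; apply: mulr_ge0.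
have X0 j : 0 <= X j.
  by rewrite mulr_ge0//; have := C01 (j + 1); have := D01 j; lra.
have U0 j : 0 <= U j by rewrite mulr_ge0//; have /andP[] := C01 (j + 1).
have V0 j : 0 <= V j by rewrite mulr_ge0//; have /andP[] := D01 j.
have Z3 j : 0 <= 3 * Z j by apply: mulr_ge0.
have ZZ j : 0 <= Z j + Z j by apply: addr_ge0.
have l2 : 0 <= lam / 2 by exact: divr_ge0.
pose Y j := 3 * Z j + Z (j + 1) + (Z (j - 1) + Z (j - 1)).
have Y0 j : 0 <= Y j.
  exact: addr_ge0 (addr_ge0 (Z3 j) (Z0 _)) (ZZ _).
have ej' j : `|e (j + 1) - e j| <= lam / 2 * Y j.
  apply: le_trans (ej j) _; apply: ler_wpM2l => //.
  have p := step_face (j - 1); rewrite (subrK 1 j) in p.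
  apply: le_trans (lerD (lerD (lerD (lerD (lerD (step_face j)
    (step_face (j + 1))) p) (step_face j)) (step_r j)) (step_l j)) _.
  by rewrite (subrK 1 j) /Y (subrK 1 j); lra.
have le_j j : `|update (j + 1) - update j| <=
    X j + U (j - 1) + V (j + 1) + lam / 2 * Y j.
  have -> : update (j + 1) - update j =
      (1 - C (j + 1) - D j) * (rho (j + 1) - rho j)
      + C j * (rho j - rho (j - 1))
      + D (j + 1) * (rho (j + 1 + 1) - rho (j + 1)) + (e (j + 1) - e j).
    by rewrite !upd (addrK 1 j); ring.
  have norm (c x : R) : 0 <= c -> `|c * x| <= c * `|x|.
    by move=> c0; rewrite normrM ger0_norm.
  apply: le_trans (ler_normD _ _) _; apply: lerD; last exact: ej'.
  apply: le_trans (ler_normD _ _) _; apply: lerD; last first.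
    by apply: norm; have /andP[] := D01 (j + 1).
  apply: le_trans (ler_normD _ _) _; apply: lerD.
    by apply: norm; have := C01 (j + 1); have := D01 j; lra.
  by rewrite /U (subrK 1 j); apply: norm; have /andP[] := C01 j.
apply: le_trans (le_bisum le_j) _.
rewrite bisumD; last 2 first.
- move=> j; apply: addr_ge0; last exact: V0.
  by apply: addr_ge0; [exact: X0|exact: U0].
- by move=> j; exact: mulr_ge0.
rewrite bisum_exchange// (eq_bisum (v := fun j => jump j)); last first.
  by move=> j; rewrite /X /U /V; ring.
have Zv : (bisum (fun j => Z j) <=
    (rate * dx * v + source * dx ^+ 2 * (L / dx))%:E)%E.
  apply: bisumD_le => [j|j||]; [exact: mulr_ge0|exact: mulr_ge0| |].
  - by apply: bisumZ_le => // j.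
  - exact: bisumZ_le.
set z := (X in X%:E) in Zv.
have Yz : (bisum Y <= (3 * z + z + (z + z))%:E)%E.
  apply: bisumD_le => [j|j||].
  - exact: addr_ge0.
  - exact: ZZ.
  - apply: bisumD_le => //; first exact: bisumZ_le.
    by rewrite (bisum_shift 1 (fun j => Z j)).
  - by apply: bisumD_le => //; rewrite (bisum_shift (-1) (fun j => Z j)).
apply: le_trans (leeD jv (bisumZ_le l2 Y0 Yz)) _.
rewrite -EFinD lee_fin /z.
rewrite le_eqVlt; apply/orP; left; apply/eqP; field.
by rewrite lt0r_neq0.
Qed.

End one_step.

(** * Total variation of piecewise constant functions *)

Section piecewise_constant.
Context {R : realType}.
Implicit Types u : int -> R.

Lemma sum_jumps_ge u (z : int) n :
  `|u (z + n%:Z) - u z| <= \sum_(i < n) `|u (z + i%:Z + 1) - u (z + i%:Z)|.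
Proof.
elim: n => [|n IH]; first by rewrite big_ord0 addr0 subrr normr0.
rewrite big_ord_recr /= -addn1 PoszD addrA.
rewrite -[X in `|X|](subrKA (u (z + n%:Z))) [X in `|X|]addrC.
by apply: le_trans (ler_normD _ _) _; rewrite lerD.
Qed.

(** Along a monotone walk on the integers each unit step is taken at most once. *)
Lemma monotone_jumps_le u (y : nat -> int) n :
  (forall i, (i < n)%N -> y i <= y i.+1) ->
  exists m : nat, y n = y 0%N + m%:Z /\
    \sum_(0 <= i < n) `|u (y i.+1) - u (y i)| <=
    \sum_(i < m) `|u (y 0%N + i%:Z + 1) - u (y 0%N + i%:Z)|.
Proof.
elim: n => [|n IH] ynd.
  by exists 0%N; rewrite addr0 big_nil big_ord0.
have [m [ym IHm]] := IH (fun i (h : (i < n)%N) => ynd i (ltnW h)).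
have [p yp] : exists p : nat, y n.+1 = y n + p%:Z.
  have := ynd n (ltnSn n); rewrite -subr_ge0 => /gez0_abs yE.
  by exists `|(y n.+1 - y n)%R|%N; rewrite yE addrC subrK.
exists (m + p)%N; rewrite yp ym PoszD addrA; split => //.
rewrite big_nat_recr//= big_split_ord /= lerD//.
rewrite yp ym; apply: le_trans (sum_jumps_ge _ _ _) _.
by apply: ler_sum => i _; rewrite PoszD addrA.
Qed.

Lemma TVR_piecewise_constant_le u (k : R -> int) :
  {homo k : x y / x <= y} ->
  (TVR (fun x => u (k x)) <= bisum (fun j => `|u (j + 1) - u j|)%R)%E.
Proof.
move=> knd; apply: (@le_trans _ _ (variationR (fun x => u (k x)))).
  by apply: ereal_inf_lbound; exists (fun x => u (k x)) => //; exact: ae_eq_refl.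
apply: ge_ereal_sup => _ [[a b] /= ab <-].
apply: ge_ereal_sup => _ [_ [s [abs _] <-] <-].
rewrite /variation.
have [i si|m [_ le_m]] :=
    @monotone_jumps_le u (fun i => k (nth b (a :: s) i)) (size s).
  by apply: knd; apply: ltW; move/(pathP b): abs; apply.
apply: (@le_trans _ _ (\sum_(i < m) `|u (k a + i%:Z + 1) - u (k a + i%:Z)|)%:E).
  by rewrite lee_fin.
have us : uniq [seq k a + i%:Z | i <- iota 0 m].
  by rewrite map_inj_uniq ?iota_uniq// => i j /addrI[].
have := sum_le_bisum us (fun j => normr_ge0 (u (j + 1) - u j)).
by rewrite big_map -[m in iota 0 m]subn0 big_mkord.
Qed.

End piecewise_constant.

(** * Cell averages of the initial datum *)

Section averages.
Context {R : realType} (rho0 : R -> R) (dx : R).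
Context (dx_gt0 : 0 < dx) (rho0_ge0 : forall x, 0 <= rho0 x).
Context (rho0_L1 : rho0 \in Lfun lebesgue_measure 1%E).
Local Notation mu := (@lebesgue_measure R).
Local Notation avg := (cell_average dx rho0).

(** Half open, so that the cells are disjoint. *)
Definition cell (j : int) : set (measurableTypeR R) :=
  `[cell_left dx j, cell_right dx j[%classic.

Let intg : mu.-integrable setT (EFin \o rho0).
Proof. exact/Lfun1_integrable. Qed.

Let meas (D : set (measurableTypeR R)) : measurable D ->
  measurable_fun D (EFin \o rho0).
Proof. by move=> mD; apply: measurable_funS (measurable_int _ intg). Qed.

Let ge0 (x : R) : (0 <= (rho0 x)%:E)%E. Proof. by rewrite lee_fin. Qed.

Let measurable_cell j : measurable (cell j).
Proof. exact: measurable_itv. Qed.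

Lemma cell_averageE j :
  ((dx * avg j)%:E = \int[mu]_(x in cell j) (rho0 x)%:E)%E.
Proof.
rewrite /cell_average mulrA divff ?gt_eqF// mul1r /Rintegral.
rewrite -integral_itv_bndo_bndc; last exact: meas.
rewrite fineK// ge0_fin_numE; last exact: integral_ge0.
apply: (@le_lt_trans _ _ (\int[mu]_x (rho0 x)%:E)%E).
  by apply: ge0_subset_integral => //; exact: meas.
rewrite -ge0_fin_numE; first exact: integrable_fin_num.
exact: integral_ge0.
Qed.

Lemma cell_average_ge0 j : 0 <= avg j.
Proof.
by rewrite -(pmulr_rge0 _ dx_gt0) -lee_fin cell_averageE integral_ge0.
Qed.

Lemma trivIset_cell : trivIset setT cell.
Proof.
apply/trivIsetP => i j _ _ ij.
wlog lt_ij : i j ij / i < j => [H|].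
  have [/H|/H|/eqP] := ltgtP i j; [exact|rewrite setIC; apply; rewrite eq_sym//|].
  by rewrite (negbTE ij).
apply/seteqP; split => // x [].
rewrite /cell /= !in_itv /= => /andP[_ xi] /andP[jx _].
have : (i + 1)%:~R * dx <= j%:~R * dx :> R.
  by rewrite ler_wpM2r ?(ltW dx_gt0)// ler_int lezD1.
rewrite intrD mulrDl mul1r; move: xi jx; rewrite /cell_right /cell_left.
rewrite /cell_center; lra.
Qed.

Lemma bisum_cell_average :
  (bisum avg <= ((\int[mu]_x rho0 x) / dx)%:E)%E.
Proof.
apply: bisum_le => s us; rewrite ler_pdivlMr// mulrC mulr_sumr -lee_fin.
rewrite -sumEFin (eq_bigr (fun j => \int[mu]_(x in cell j) (rho0 x)%:E)%E);
  last by move=> j _; exact: cell_averageE.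
have mU : measurable (\big[setU/set0]_(j <- s) cell j).
  by apply: bigsetU_measurable => j _; exact: measurable_cell.
rewrite -ge0_integral_bigsetU//; last 2 first.
- exact: sub_trivIset trivIset_cell.
- exact: meas.
rewrite /Rintegral fineK; last exact: integrable_fin_num.
by apply: ge0_subset_integral => //; exact: meas.
Qed.

Lemma cell_average_le (c : R) : 0 <= c -> {ae mu, forall x, rho0 x <= c} ->
  forall j, avg j <= c.
Proof.
move=> c0 rc j; rewrite -(ler_pM2l dx_gt0) -lee_fin cell_averageE.
apply: (@le_trans _ _ (\int[mu]_(x in cell j) (cst c%:E) x)%E).
  apply: ae_ge0_le_integral => //.
  - exact: meas.
  - case: rc => N [mN N0 sN]; exists N; split => // x xN; apply: sN => /= xc.
    by apply: xN => _; rewrite lee_fin.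
have w : cell_right dx j - cell_left dx j = dx.
  by rewrite /cell_right /cell_left; field.
have muE : mu (cell j) = dx%:E.
  have := lebesgue_measure_itv `[cell_left dx j, cell_right dx j[.
  by rewrite /= lte_fin -subr_gt0 w dx_gt0 -EFinD w.
rewrite integral_cst// [X in (_ * X)%E](_ : _ = dx%:E); last exact: muE.
by rewrite -EFinM mulrC.
Qed.

End averages.

(** * Iteration *)

Lemma Loo_bound (R : realType) (g : R -> R) :
  g \in Lfun (@lebesgue_measure R) +oo%E ->
  exists2 c : R, 0 <= c & {ae (@lebesgue_measure R), forall x, g x <= c}.
Proof.
have T0 : (0 < (@lebesgue_measure R) [set: measurableTypeR R])%E.
  have := @lebesgue_measure_itv R `]-oo, +oo[%R; rewrite set_itvNyy /= => ->.
  by rewrite ltry.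
move=> /sub_Lfun_finLfun/set_mem g_fin.
have {g_fin} : ('N[@lebesgue_measure R]_+oo[EFin \o g] < +oo)%E by [].
rewrite unlock T0.
have := ess_sup_ge (@lebesgue_measure R) (abse \o (EFin \o g)).
case: (ess_sup _ _) => [s| |] [N [mN N0 sN]]; last 2 first.
- by rewrite ltxx.
- exists 0 => //; exists N; split => //; apply: subset_trans sN => x /= _.
  by rewrite leeNy_eq.
exists `|s| => //; exists N; split => //; apply: subset_trans sN => x /= xs gx.
apply: xs; apply: le_trans (ler_norm _) _; apply: le_trans (ler_norm s).
by rewrite -lee_fin.
Qed.

Section iteration.
Context {R : realType} (f : R * R -> R) (mu rho0 : R -> R).
Context (theta alpha dx dt N M K m m0 m1 m2 B L r T : R).
Local Notation lam := (dt / dx).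
Context (theta_bounds : 0 <= theta <= 1 / 2) (alpha_bounds : 0 < alpha < 8 / 27).
Context (dx_gt0 : 0 < dx) (dt_gt0 : 0 < dt) (N_ge0 : 0 <= N) (M_ge0 : 0 <= M).
Context (K_ge0 : 0 <= K) (m1_ge0 : 0 <= m1) (m2_ge0 : 0 <= m2) (L_ge0 : 0 <= L).
Context (cfl1 : lam * N <= 2 / 27) (cfl2 : lam * N <= alpha).
Context (f0 : forall a, f (0, a) = 0).
Context (f_lip : forall x y a, `|f (x, a) - f (y, a)| <= N * `|x - y|).
Context (f_lipA : forall x a b, `|f (x, a) - f (x, b)| <= M * `|x| * `|a - b|).
Context (f_incA : forall x a b c d,
  `|(f (x, a) - f (x, b)) - (f (x, c) - f (x, d))| <=
    M * `|x| * `|(a - b) - (c - d)|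
    + M * `|x| * (`|a - c| + `|a - b| + `|c - d|) * `|c - d|).
Context (f_mix : forall x y a b,
  `|x| <= m -> `|y| <= m -> `|a| <= m -> `|b| <= m ->
  `|(f (x, a) - f (x, b)) - (f (y, a) - f (y, b))| <= K * `|x - y| * `|a - b|).
Context (mu_supp : forall x, B < `|x| -> mu x = 0).
Context (mu0 : forall x, `|mu x| <= m0).
Context (mu1 : forall x h, `|mu (x + h) - mu x| <= m1 * `|h|).
Context (mu2 : forall x h,
  `|mu (x + h) - 2 * mu x + mu (x - h)| <= m2 * h ^+ 2).
Local Notation c1 := (2 * (m1 * L)).
Local Notation c2 := (2 * (m2 * L)).
Local Notation rho n := (muscl f mu theta alpha dx dt rho0 n).
Local Notation jumps n := (bisum (fun j => `|rho n (j + 1) - rho n j|)%R).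
Context (avg_ge0 : forall j, 0 <= cell_average dx rho0 j).
Context (avg_mass : (bisum (cell_average dx rho0) <= (L / dx)%:E)%E).
Context (r_ge0 : 0 <= r) (avg_le : forall j, cell_average dx rho0 j <= r).
Context (conv_m : 2 * (m0 * L) <= m).
Context (max_m : 2 * (expR (5 * M * c1 * T) * r) <= m).

Lemma muscl_ge0_mass n :
  (forall j, 0 <= rho n j) /\ (bisum (rho n) <= (L / dx)%:E)%E.
Proof.
elim: n => [|n [IH1 IH2]]; first by split.
rewrite /muscl iterS -/(rho n).
split=> [j|]; first exact: (update_ge0 _ theta_bounds alpha_bounds dx_gt0 dt_gt0
  cfl1 cfl2 f0 f_lip IH1).
by rewrite (bisum_update _ theta_bounds alpha_bounds dx_gt0 dt_gt0
  cfl1 cfl2 f0 f_lip IH1).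
Qed.

Let tS n : n.+1%:R * dt = n%:R * dt + dt.
Proof. by rewrite -natr1 mulrDl mul1r. Qed.

(** [1 + x <= expR x] turns the growth factors of the steps up to time [T] into
    one exponential. *)
Lemma muscl_max n : n%:R * dt <= T -> forall j, 2 * rho n j <= m.
Proof.
have q0 : 0 <= 5 * M * c1.
  exact: mulr_ge0 (mulr_ge0 (ler0n _ 5) M_ge0)
    (mulr_ge0 (ler0n _ 2) (mulr_ge0 m1_ge0 L_ge0)).
have key j : rho n j <= expR (5 * M * c1 * (n%:R * dt)) * r.
  elim: n j => [|n IH] j; first by rewrite mul0r mulr0 expR0 mul1r; exact: avg_le.
  have [r0 rm] := muscl_ge0_mass n.
  rewrite /muscl iterS -/(rho n).
  apply: le_trans (update_le theta_bounds alpha_bounds dx_gt0 dt_gt0 M_ge0 m1_ge0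
    L_ge0 cfl1 cfl2 f0 f_lip f_lipA mu_supp mu0 mu1 mu2 r0 rm IH j) _.
  rewrite tS (mulrDr (5 * M * c1)) expRD mulrA.
  rewrite [X in _ <= X * _]mulrC ler_wpM2r//.
  by apply: ler_wpM2r; rewrite ?expR_ge0// expR_ge1Dx.
move=> nT j; apply: le_trans max_m; rewrite ler_pM2l//.
by apply: le_trans (key j) _; rewrite ler_wpM2r// ler_expR ler_wpM2l.
Qed.

(** The discrete Gronwall inequality. *)
Lemma muscl_jumps (a b v : R) : 3 * tv_rate K c1 <= a ->
  3 * tv_source lam K M c1 c2 * L <= b * a -> 0 <= a -> 0 <= b -> 0 <= v ->
  (jumps 0 <= v%:E)%E -> forall n, n%:R * dt <= T ->
  (jumps n <= (expR (a * (n%:R * dt)) * v + b * (expR (a * (n%:R * dt)) - 1))%:E)%E.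
Proof.
move=> a_ge b_ge a0 b0 v0 j0; elim=> [|n IH] nT.
  by rewrite mul0r mulr0 expR0 mul1r subrr mulr0 addr0.
have nT' : n%:R * dt <= T.
  by apply: le_trans nT; rewrite tS lerDl ltW.
have [r0 rm] := muscl_ge0_mass n.
apply: le_trans (bisum_jump_update theta_bounds alpha_bounds dx_gt0 dt_gt0
  N_ge0 M_ge0 m1_ge0 L_ge0 cfl1 cfl2 f0 f_lip f_lipA mu_supp mu0 mu1 mu2 r0 rm
  K_ge0 f_incA f_mix (muscl_max nT') conv_m m2_ge0 (IH nT')) _.
rewrite lee_fin tS (mulrDr a) expRD.
set x := expR (a * (n%:R * dt)).
have x1 : 1 <= x by rewrite -expR0 ler_expR !mulr_ge0// ltW.
have y1 : 1 + a * dt <= expR (a * dt) by exact: expR_ge1Dx.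
have dt0 := ltW dt_gt0.
have w0 : 0 <= x * v + b * (x - 1).
  by rewrite addr_ge0// mulr_ge0//; lra.
apply: (@le_trans _ _ ((1 + a * dt) * (x * v + b * (x - 1)) + b * a * dt)).
  by apply: lerD; apply: ler_wpM2r => //; rewrite lerD2l ler_wpM2r.
have : 0 <= (expR (a * dt) - (1 + a * dt)) * (x * v + b * x).
  apply: mulr_ge0; first by rewrite subr_ge0.
  by rewrite addr_ge0// mulr_ge0//; lra.
lra.
Qed.

End iteration.

Theorem theorem4p4 (R : realType) (f : R * R -> R) (mu : R -> R)
    (theta alpha lam : R) (rho0 : R -> R) (T : R)
    (f_hyp : flux_hyp f) (mu_hyp : kernel_hyp mu)
    (theta_bounds : 0 <= theta <= 1 / 2) (alpha_bounds : 0 < alpha < 8 / 27)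
    (rho0_ge0 : forall x, 0 <= rho0 x)
    (rho0_Loo : rho0 \in Lfun lebesgue_measure +oo%E) (rho0_BV : BVR rho0)
    (T_gt0 : 0 < T) (lam_gt0 : 0 < lam) (cfl : CFL f alpha lam) :
  exists A B : R, [/\ 0 < A, 0 < B &
    forall dx dt : R, 0 < dx -> 0 < dt -> dt / dx = lam ->
    forall t : R, 0 <= t <= T ->
      (TVR (rho_Delta f mu theta alpha dx dt rho0 t) <=
       (expR (A * T))%:E *
         (\esum_(j in [set: int])
            `|cell_average dx rho0 (j + 1) - cell_average dx rho0 j|%:E) +
       (B * (expR (A * T) - 1))%:E)%E].
Proof.
have [f2 _ f0 [M [M_gt0 fM]] _] := f_hyp.
have [alpha_gt0 _] := andP alpha_bounds.
have [N [N_ge0 fN cfl1 cfl2]] := CFL_bound f_hyp alpha_gt0 lam_gt0 cfl.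
have f_lip : forall x y a, `|f (x, a) - f (y, a)| <= N * `|x - y|.
  by apply: flux_lip_rho => //; case: f2 => _ [].
have f_lipA : forall x a b, `|f (x, a) - f (x, b)| <= M * `|x| * `|a - b|.
  by apply: flux_lip_A => // r a; case: (fM r a).
have f_incA := flux_increment_A f2 fM.
have [B0 mu_supp [m0 [m1 [m2 [m00 m10 m20 [mu0 mu1 mu2]]]]]] := kernel_bounds mu_hyp.
have [c c_ge0 rho0_c] := Loo_bound rho0_Loo.
have [rho0_L1 _] := rho0_BV.
pose L := \int[lebesgue_measure]_x rho0 x.
have L_ge0 : 0 <= L by apply: Rintegral_ge0.
pose c1 := 2 * (m1 * L); pose c2 := 2 * (m2 * L).
pose m := Num.max (2 * (m0 * L)) (2 * (expR (5 * M * c1 * T) * c)).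
have [K K_ge0 f_mix] := flux_mixed f2 m.
have M_ge0 := ltW M_gt0.
have c1_ge0 : 0 <= c1 by rewrite !mulr_ge0.
have c2_ge0 : 0 <= c2 by rewrite !mulr_ge0.
have rate_ge0 : 0 <= tv_rate K c1 by rewrite !mulr_ge0.
have source_ge0 : 0 <= tv_source lam K M c1 c2 * L.
  apply: mulr_ge0 => //; apply: addr_ge0; apply: mulr_ge0; rewrite ?sqr_ge0//.
  - by rewrite !mulr_ge0// ltW.
  - by rewrite mulr_ge0.
  - by rewrite addr_ge0// mulr_ge0// sqr_ge0.
pose A := 3 * tv_rate K c1 + 1; pose b := 3 * (tv_source lam K M c1 c2 * L) + 1.
have A_gt0 : 0 < A by rewrite /A; lra.
have b_gt0 : 0 < b by rewrite /b; lra.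
exists A, (b / A); split => //; first exact: divr_gt0.
move=> dx dt dx_gt0 dt_gt0 lamE t /andP[t0 tT].
pose n := Num.truncn (t / dt).
have nT : n%:R * dt <= T.
  apply: le_trans tT; rewrite -ler_pdivlMr//.
  by case/andP: (truncn_itv (divr_ge0 t0 (ltW dt_gt0))).
rewrite -lamE in cfl1 cfl2.
pose u k := muscl f mu theta alpha dx dt rho0 k.
have floor_nd : {homo (fun x : R => Num.floor (x / dx + 2^-1)) : x y / x <= y}.
  by move=> x y xy; apply: le_floor; rewrite lerD2r ler_wpM2r// invr_ge0 ltW.
apply: le_trans (TVR_piecewise_constant_le (u n) floor_nd) _.
set J0 := (\esum_(j in _) _)%E.
have J0E : bisum (fun j => `|u 0%N (j + 1) - u 0%N j|) = J0 by [].
have J0_ge0 : (0 <= J0)%E by rewrite -J0E bisum_ge0.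
clearbody J0; case: J0 J0_ge0 J0E => [v| |]//; last first.
  by move=> _ _; rewrite gt0_muley ?lte_fin ?expR_gt0// addye// leey.
rewrite lee_fin => v0 J0E; rewrite -EFinM -EFinD.
have jumps := @muscl_jumps R f mu rho0 theta alpha dx dt N M K m m0 m1 m2 B0 L c T
  theta_bounds alpha_bounds dx_gt0 dt_gt0 N_ge0 M_ge0 K_ge0 m10 m20 L_ge0
  cfl1 cfl2 f0 f_lip f_lipA f_incA f_mix mu_supp mu0 mu1 mu2
  (cell_average_ge0 dx_gt0 rho0_ge0 rho0_L1)
  (bisum_cell_average dx_gt0 rho0_ge0 rho0_L1) c_ge0
  (cell_average_le dx_gt0 rho0_ge0 rho0_L1 c_ge0 rho0_c).
have max1 : 2 * (m0 * L) <= m by rewrite le_max lexx.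
have max2 : 2 * (expR (5 * M * c1 * T) * c) <= m by rewrite le_max lexx orbT.
apply: le_trans (jumps max1 max2 A (b / A) v _ _ _ _ v0 _ n nT) _.
- by rewrite lerDl.
- by rewrite lamE divfK ?gt_eqF// /b; lra.
- exact: ltW.
- by rewrite ltW// divr_gt0.
- by rewrite -J0E.
have mono : expR (A * (n%:R * dt)) <= expR (A * T).
  by rewrite ler_expR ler_wpM2l// ltW.
rewrite lee_fin lerD// ?ler_wpM2r// ler_wpM2l ?lerD2r//.
by rewrite ltW// divr_gt0.
Qed.
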